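(* For every integer $h\ge 1$, let $\alpha$ be the smallest number of the form $N^2$ or $N(N+1)$ ($N$ a positive integer) such that $h\le h_\alpha$. Then $g(h)=g(h_\alpha)-2(h_\alpha-h)$.
   Context: A polyomino is a finite union of closed unit squares (tiles) of the square lattice, any two meeting (if at all) in a whole edge, whose interior is connected. Its holes are the bounded connected components of its complement in the plane; $h(A)$ is the number of holes of $A$ and $|A|$ its number of tiles. For $h\ge 1$, $g(h)=\min\{|A| : A \text{ a polyomino with } h(A)=h\}$. For a positive integer $N$ and $\alpha\in\{N^2, N(N+1)\}$, $h_\alpha$ denotes the maximum number of holes of a polyomino contained in the $N\times N$ square (if $\alpha=N^2$), respectively in the $N\times(N+1)$ rectangle (if $\alpha=N(N+1)$). *)

(* Defs.v *)
From HB Require Import structures.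
From mathcomp Require Import all_boot all_order all_algebra.
From mathcomp Require Import finmap.
Set Implicit Arguments. Unset Strict Implicit. Unset Printing Implicit Defensive.
Import Order.TTheory GRing.Theory Num.Theory.
Local Open Scope fset_scope.

(* The tile (closed unit square) [x,x+1] x [y,y+1] is represented by (x,y). *)
Definition cell := (int * int)%type.

Definition adj (c d : cell) : bool :=
  (absz (c.1 - d.1)%R + absz (c.2 - d.2)%R == 1)%N.

Definition tileset := {fset cell}.

(* Interior of the union of the tiles is connected: nonempty and any two
   tiles are joined by a chain of edge-adjacent tiles of A. *)
Definition polyomino (A : tileset) : Prop :=
  A != fset0 /\
  forall c d, c \in A -> d \in A ->
    exists p : seq cell, [/\ path adj c p, last c p = d & all (fun x => x \in A) p].

(* c and d (cells not in A) lie in the same connected component of the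
   complement of A in the plane: joined by an edge-adjacent chain of cells
   outside A. *)
Definition reach_out (A : tileset) (c d : cell) : Prop :=
  exists p : seq cell,
    [/\ path adj c p, last c p = d & all (fun x => x \notin A) (c :: p)].

(* A hole: a bounded (here: finite set of cells) connected component of the
   complement of A. *)
Definition hole (A : tileset) (H : {fset cell}) : Prop :=
  [/\ H != fset0,
      forall c, c \in H -> c \notin A,
      forall c d, c \in H -> reach_out A c d -> d \in H &
      forall c d, c \in H -> d \in H -> reach_out A c d].

Definition num_holes (A : tileset) (n : nat) : Prop :=
  exists s : seq {fset cell},
    [/\ uniq s, size s = n & forall H, hole A H <-> H \in s].

Definition is_min (P : nat -> Prop) (m : nat) : Prop :=
  P m /\ forall k, P k -> (m <= k)%N.
Definition is_max (P : nat -> Prop) (m : nat) : Prop :=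
  P m /\ forall k, P k -> (k <= m)%N.

Definition g_is (h m : nat) : Prop :=
  is_min (fun k => exists A, [/\ polyomino A, num_holes A h & #|` A| = k]) m.

Definition in_rect (N M : nat) (A : tileset) : Prop :=
  forall c, c \in A ->
    [&& (0 <= c.1)%R, (c.1 < N%:Z)%R, (0 <= c.2)%R & (c.2 < M%:Z)%R].

Definition hmax_is (N M m : nat) : Prop :=
  is_max (fun k => exists A, [/\ polyomino A, in_rect N M A & num_holes A k]) m.

(* alpha = N (N + b), b in {0,1}, N >= 1, is the smallest number of the form
   N^2 or N(N+1) with h <= h_alpha, and ha = h_alpha. *)
Definition smallest_alpha (h N b ha : nat) : Prop :=
  [/\ (b <= 1)%N, (1 <= N)%N, hmax_is N (N + b) ha, (h <= ha)%N &
      forall N' b' ha', (b' <= 1)%N -> (1 <= N')%N ->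
        (N' * (N' + b') < N * (N + b))%N -> hmax_is N' (N' + b') ha' ->
        (ha' < h)%N].

(* Main.v *)
(* Count tile sides: a connected polyomino with n tiles has at least n - 1
   adjacencies, every hole has at least 4 sides, and every nonempty row or column
   shows 2 sides to the outside. Hence n >= 2 h - 1 + s, where s is the
   semiperimeter of the bounding box; call a polyomino tight when this is an
   equality.

   Keeping one cell r of each hole, the whole N x M box minus these cells is still
   connected, so the count applied to it gives 3 h <= (N-1)(M-1) - 1, improved to
   (N-1)(M-1) - 3 when N is even and M > 3. In the box of alpha, therefore, either
   h_alpha = floor((N-1)(M-1)/3) - 1 =: opt, or the box is a square with
   3 h_alpha = (N-1)^2 - 1, and then cutting one corner of the box gives a tight
   polyomino.

   Configurations with opt holes come from an inductive step adding three rows,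
   whose zigzag of holes uses up one free corner and leaves another one free.
   Tight polyominoes for all h with opt' < h <= opt, where opt' is the value for
   the preceding alpha, come from cutting corners, from strips added only
   partially, from opening a hole at a corner, and from doubling the scale. *)
Require Import Defs.
From Stdlib Require Import Classical.
From mathcomp Require Import all_boot all_order all_algebra.
From mathcomp Require Import finmap zify.
Set Implicit Arguments. Unset Strict Implicit. Unset Printing Implicit Defensive.
Import Order.TTheory GRing.Theory Num.Theory.
Local Open Scope fset_scope.
Local Open Scope ring_scope.

(** * Chains of cells and one-cell holes *)

(** The linear law comes from the exact value g(h) = 2h + 2N + b - 1, valid for every h whose
    smallest alpha is N(N+b); since h and h_alpha have the same smallest alpha, subtraction gives
    the theorem. No closed form of h_alpha is needed, only [opt] <= h_alpha and the bound on 3h. The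
    side count alone does not give this lower bound: the semiperimeter p + q of the bounding box
    must be at least 2N + b. Otherwise the most balanced box with the same p + q has a smaller
    alpha, hence fewer than h holes; but if p x q is less balanced, (p-1)(q-1) drops so much that,
    with residues modulo 3, h is at most [opt] of the balanced box. A box with h unit holes and K
    corners cut is tight exactly when 3h + K = (N-1)(M-1), which explains the 3 corners behind [opt]
    and the single corner of the exceptional square. The obstacle is divisibility by 3 in the box of
    alpha. Tightness involves only the semiperimeter, so the constructions may leave that box and
    use another one of equal semiperimeter whose product is divisible by 3. *)

Definition link (P : pred cell) (c d : cell) : Prop :=
  exists p : seq cell, [/\ path adj c p, last c p = d & all P (c :: p)].

Lemma adjC c d : adj c d = adj d c.
Proof. rewrite /adj; lia. Qed.

Lemma link_refl (P : pred cell) c : P c -> link P c c.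
Proof. by move=> Pc; exists [::]; split=> //=; rewrite Pc. Qed.

Lemma link1 (P : pred cell) c d : P c -> P d -> adj c d -> link P c d.
Proof. by move=> Pc Pd cd; exists [:: d]; rewrite /= Pc Pd cd. Qed.

Lemma link_trans (P : pred cell) d c e : link P c d -> link P d e -> link P c e.
Proof.
move=> [p [pp <- ap]] [q [pq <- aq]]; exists (p ++ q); split.
- by rewrite cat_path pp.
- by rewrite last_cat.
- by move: ap aq; rewrite /= all_cat => /andP[-> ->] /andP[_ ->].
Qed.

Lemma link_ind (P : pred cell) (Q : cell -> Prop) c d :
  link P c d -> Q c ->
  (forall x y, P x -> P y -> adj x y -> Q x -> Q y) -> Q d.
Proof.
move=> [p [pp <- ap]] Qc H; elim: p c pp ap Qc => //= x p IH c /andP[cx pp].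
by move=> /and3P[Pc Px ap] Qc; apply: IH; rewrite /= ?Px //; apply: H Qc.
Qed.

Lemma link_in (P : pred cell) c d : link P c d -> P c /\ P d.
Proof.
move=> [p [_ <- ap]]; split; first by case/andP: ap.
by move/allP: ap => /(_ (last c p)); apply; apply: mem_last.
Qed.

Lemma link_sym (P : pred cell) c d : link P c d -> link P d c.
Proof.
move=> L; have [Pc _] := link_in L; apply: (link_ind (Q := fun e => link P e c) L); first exact: link_refl.
by move=> x y Px Py xy; apply: link_trans; apply: link1; rewrite // adjC.
Qed.

Lemma link_sub (P Q : pred cell) c d :
  (forall x, P x -> Q x) -> link P c d -> link Q c d.
Proof.
move=> PQ [p [pp lp ap]]; exists p; split=> //.
by apply: sub_all ap => x /PQ.
Qed.

Lemma link_hseg (P : pred cell) x0 x1 y : x0 <= x1 ->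
  (forall x, x0 <= x -> x <= x1 -> P (x, y)) -> link P (x0, y) (x1, y).
Proof.
move=> le; have [n ->] : exists n : nat, x1 = x0 + n%:Z by exists `|x1 - x0|%N; lia.
elim: n => [|n IH] H; first by rewrite addr0; apply: link_refl; apply: H; lia.
apply: (link_trans (d := (x0 + n%:Z, y))).
  by apply: IH => x ? ?; apply: H; lia.
by apply: link1; rewrite ?H /adj /=; lia.
Qed.

Lemma link_vseg (P : pred cell) x y0 y1 : y0 <= y1 ->
  (forall y, y0 <= y -> y <= y1 -> P (x, y)) -> link P (x, y0) (x, y1).
Proof.
move=> le; have [n ->] : exists n : nat, y1 = y0 + n%:Z by exists `|y1 - y0|%N; lia.
elim: n => [|n IH] H; first by rewrite addr0; apply: link_refl; apply: H; lia.
apply: (link_trans (d := (x, y0 + n%:Z))).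
  by apply: IH => y ? ?; apply: H; lia.
by apply: link1; rewrite ?H /adj /=; lia.
Qed.

Notation lk A := (link (fun c : cell => c \in A)).

Lemma polyomino_link A c d : polyomino A -> c \in A -> d \in A -> lk A c d.
Proof.
by move=> [_ H] cA dA; have [p [? ? ?]] := H _ _ cA dA; exists p; rewrite /= cA.
Qed.

Lemma polyomino_root A r : r \in A -> (forall c, c \in A -> lk A r c) -> polyomino A.
Proof.
move=> rA H; split; first by apply/fset0Pn; exists r.
move=> c d /H rc /H; case/(link_trans (link_sym rc)) => p [? ? /= /andP[_ ?]].
by exists p.
Qed.

Lemma polyomino_nonempty A : polyomino A -> exists c, c \in A.
Proof. by case=> /fset0Pn. Qed.

Lemma polyomino_ind A (Q : cell -> Prop) c : polyomino A -> c \in A -> Q c ->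
  (forall x y, x \in A -> y \in A -> adj x y -> Q x -> Q y) ->
  forall d, d \in A -> Q d.
Proof. by move=> pA cA Qc H d dA; apply: (link_ind (polyomino_link pA cA dA)). Qed.

(** On a walk in [A] starting at [t], each return to [t] is harmless: the next cell is a neighbour
    of [t], already linked to [r] inside [B]. This serves for deleting a tile and also when [B]
    gains new tiles elsewhere. *)
Lemma link_exchange (A B : tileset) t r : polyomino A -> t \in A ->
  (forall c, c \in A -> c != t -> c \in B) ->
  (forall n, n \in A -> adj t n -> lk B r n) ->
  forall c, c \in A -> c != t -> lk B r c.
Proof.
move=> pA tA AB nb c cA ct; have : c = t \/ lk B r c; last first.
  by case=> // /eqP; rewrite (negbTE ct).
apply: (polyomino_ind (Q := fun c => c = t \/ lk B r c) pA tA) cA; first by left.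
move=> x y xA yA xy [xt|rx]; first by right; apply: nb; rewrite -?xt.
have [->|yt] := eqVneq y t; [by left|right].
by apply: (link_trans rx); apply: link1 => //; [case/link_in: rx|apply: AB].
Qed.

Lemma polyomino_remove A t r : polyomino A -> t \in A -> r \in A -> r != t ->
  (forall n, n \in A -> adj t n -> lk (A `\ t) r n) -> polyomino (A `\ t).
Proof.
move=> pA tA rA rt nb; apply: (polyomino_root (r := r)); first by rewrite !inE rt.
move=> c; rewrite !inE => /andP[ct cA].
by apply: (link_exchange pA tA) => // d dA dt; rewrite !inE dt.
Qed.

(* A straight ray issued from [c] avoids [A], so [c] lies in the unbounded
   component of the complement. *)
Definition escapes (A : tileset) (c : cell) : Prop :=
  [\/ forall z, c.1 <= z -> (z, c.2) \notin A,
      forall z, z <= c.1 -> (z, c.2) \notin A,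
      forall z, c.2 <= z -> (c.1, z) \notin A |
      forall z, z <= c.2 -> (c.1, z) \notin A].

Lemma fset_no_inj (H : {fset cell}) (f : nat -> cell) :
  injective f -> (forall k, f k \in H) -> False.
Proof.
move=> fI fH; have := @uniq_leq_size _ (map f (iota 0 (#|` H|).+1)) H.
rewrite map_inj_uniq ?iota_uniq // size_map size_iota ltnn => F.
suff: false by []. apply: F => // x /mapP[k _ ->]; exact: fH.
Qed.

Lemma escapes_nohole A H c : escapes A c -> hole A H -> c \notin H.
Proof.
move=> fr [_ _ cl _]; apply/negP => cH.
have cl' d : link (fun x => x \notin A) c d -> d \in H by apply: cl.
case: c fr cl' {cl cH} => x y /= fr cl.
case: fr => fr.
- apply: (@fset_no_inj H (fun k => (x + k%:Z, y))); first by move=> i j [] ; lia.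
  move=> k; apply/cl/link_hseg; first lia. by move=> z ? ?; apply: fr.
- apply: (@fset_no_inj H (fun k => (x - k%:Z, y))); first by move=> i j [] ; lia.
  move=> k; apply/cl/link_sym/link_hseg; first lia. by move=> z ? ?; apply: fr.
- apply: (@fset_no_inj H (fun k => (x, y + k%:Z))); first by move=> i j [] ; lia.
  move=> k; apply/cl/link_vseg; first lia. by move=> z ? ?; apply: fr.
- apply: (@fset_no_inj H (fun k => (x, y - k%:Z))); first by move=> i j [] ; lia.
  move=> k; apply/cl/link_sym/link_vseg; first lia. by move=> z ? ?; apply: fr.
Qed.

(* The holes of [A] are exactly the single cells of [R]. *)
Definition pits (A : tileset) (R : {fset cell}) : Prop :=
  [/\ forall r, r \in R -> r \notin A,
      forall r d, r \in R -> adj r d -> d \in A &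
      forall c, c \notin A -> c \notin R -> escapes A c].

Lemma pits_hole A R r : pits A R -> r \in R -> hole A [fset r].
Proof.
move=> [RA Rn _] rR; split.
- by apply/fset0Pn; exists r; rewrite inE.
- by move=> c; rewrite inE => /eqP ->; apply: RA.
- move=> c d; rewrite inE => /eqP -> [[|x p] [pp <- ap]]; first by rewrite /= inE.
  by case/andP: pp => /(Rn _ _ rR) xA; move: ap; rewrite /= xA andbF.
- move=> c d; rewrite !inE => /eqP -> /eqP ->.
  by apply: (@link_refl (fun x => x \notin A)); apply: RA.
Qed.

(** The third clause of [pits] rules out further holes: a hole meeting no cell of [R] would contain
    a cell with a free ray, hence infinitely many cells. *)
Lemma pits_num A R : pits A R -> num_holes A #|` R|.
Proof.
move=> pR; exists [seq [fset r] | r <- R]; split.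
- by rewrite map_inj_uniq // => x y /fset1_inj.
- by rewrite size_map.
move=> H; split; last by case/mapP => r rR ->; apply: (pits_hole pR).
case: (pR) => [RA Rn Rf] hH; have [/fset0Pn[c cH] HA cl co] := hH.
have cR : c \in R.
  by apply: contraT => cR; move: (escapes_nohole (Rf _ (HA _ cH) cR) hH); rewrite cH.
apply/mapP; exists c => //; apply/fsetP => d; rewrite inE; apply/idP/eqP => [dH|->//].
have [_ _ cl1 _] := pits_hole pR cR.
by apply/eqP; rewrite -in_fset1; apply: cl1 (co _ _ cH dH); rewrite inE.
Qed.

(** Since [escapes] speaks of straight rays, its preservation is a separate field, checked directly
    for the reflections and the swap instead of being derived from adjacency. *)
Record cell_iso (f g : cell -> cell) : Prop := CellIso {
  isoK : cancel f g;
  isoVK : cancel g f;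
  iso_adj : forall c d, adj (f c) (f d) = adj c d;
  iso_escapes : forall (A : tileset) c, escapes A c -> escapes (f @` A) (f c) }.

Section Isometry.
Variables (f g : cell -> cell) (fg : cell_iso f g).

Lemma mem_iso (A : {fset cell}) c : (c \in f @` A) = (g c \in A).
Proof.
apply/imfsetP/idP => [[x xA ->]|gA]; first by rewrite (isoK fg).
by exists (g c); rewrite ?(isoVK fg).
Qed.

Lemma mem_isof (A : {fset cell}) c : (f c \in f @` A) = (c \in A).
Proof. by rewrite mem_iso (isoK fg). Qed.

Lemma card_iso (A : {fset cell}) : #|` f @` A| = #|` A|.
Proof. exact/card_imfset/can_inj/(isoK fg). Qed.

Lemma link_iso (P Q : pred cell) c d :
  (forall x, P x -> Q (f x)) -> link P c d -> link Q (f c) (f d).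
Proof.
move=> PQ L; have [Pc _] := link_in L.
apply: (link_ind (Q := fun e => link Q (f c) (f e)) L).
  by apply: link_refl; apply: PQ.
move=> x y Px Py xy cx; apply: (link_trans cx); apply: link1; rewrite ?PQ //.
by rewrite (iso_adj fg).
Qed.

Lemma polyomino_iso A : polyomino A -> polyomino (f @` A).
Proof.
move=> pA; have [r rA] := polyomino_nonempty pA.
apply: (polyomino_root (r := f r)); first by rewrite mem_isof.
move=> c; rewrite mem_iso => /(polyomino_link pA rA).
rewrite -{2}(isoVK fg c); apply: link_iso => x; by rewrite mem_isof.
Qed.

Lemma pits_iso A R : pits A R -> pits (f @` A) (f @` R).
Proof.
move=> [RA Rn Rf]; split.
- by move=> r; rewrite !mem_iso; apply: RA.
- move=> r d; rewrite !mem_iso => rR rd; apply: (Rn _ _ rR).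
  by rewrite -(iso_adj fg) !(isoVK fg).
- move=> c; rewrite !mem_iso => cA cR.
  by rewrite -(isoVK fg c); apply: (iso_escapes fg); apply: Rf.
Qed.

Lemma hole_iso A H : hole A H -> hole (f @` A) (f @` H).
Proof.
move=> [H0 HA cl co]; split.
- by rewrite -cardfs_gt0 card_iso cardfs_gt0.
- by move=> c; rewrite !mem_iso; apply: HA.
- move=> c d; rewrite !mem_iso => cH L; apply: (cl _ _ cH).
  have gf c' d' : adj (g c') (g d') = adj c' d' by rewrite -(iso_adj fg) !(isoVK fg).
  case: L => p [pp lp ap]; exists (map g p); split.
  + by rewrite path_map; apply: sub_path pp => x y; rewrite /= gf.
  + by rewrite last_map lp.
  + rewrite -map_cons all_map; apply: sub_all ap => x /=; by rewrite mem_iso.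
- move=> c d; rewrite !mem_iso => cH dH; rewrite -(isoVK fg c) -(isoVK fg d).
  apply: (link_iso _ (co _ _ cH dH)) => x; by rewrite mem_isof.
Qed.

End Isometry.

Lemma num_holes_iso f g A h : cell_iso f g -> cell_iso g f ->
  num_holes A h -> num_holes (f @` A) h.
Proof.
move=> fg gf [s [us ss hs]]; exists [seq f @` H | H : {fset cell} <- s].
have inv (B : {fset cell}) : g @` (f @` B) = B.
  by apply/fsetP => c; rewrite (mem_iso gf) (mem_isof fg).
have inv' (B : {fset cell}) : f @` (g @` B) = B.
  by apply/fsetP => c; rewrite (mem_iso fg) (mem_isof gf).
split; last 1 first.
- move=> H; split.
    move/(hole_iso gf); rewrite inv => /hs Hs; apply/mapP.
    by exists (g @` H); rewrite ?inv'.
  by case/mapP => H' /hs hH' ->; exact: (hole_iso fg hH').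
- by rewrite map_inj_uniq // => H H' E; rewrite -(inv H) -(inv H') E.
- by rewrite size_map.
Qed.

Definition flipx (k : int) (c : cell) : cell := (k - c.1, c.2).
Definition flipy (k : int) (c : cell) : cell := (c.1, k - c.2).
Definition swap (c : cell) : cell := (c.2, c.1).

Lemma iso_invol f : involutive f ->
  (forall c d, adj (f c) (f d) = adj c d) ->
  (forall (A : tileset) c, escapes A c -> (forall d, d \in f @` A -> f d \in A) ->
     escapes (f @` A) (f c)) -> cell_iso f f.
Proof.
move=> fK fa ff; split=> // A c /ff; apply => d /imfsetP[x xA ->].
by rewrite fK.
Qed.

Lemma escapes_contra (A B : tileset) (f : cell -> cell) z w :
  (forall d, d \in B -> f d \in A) -> f z = w -> w \notin A -> z \notin B.
Proof. by move=> H <-; apply: contra; apply: H. Qed.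

Lemma iso_flipx k : cell_iso (flipx k) (flipx k).
Proof.
apply: iso_invol => [[x y]|[x y] [z w]|A [x y] fr H]; rewrite /flipx /=.
- by congr pair; lia.
- by rewrite /adj /=; lia.
case: fr => /= fr; [apply: Or42|apply: Or41|apply: Or43|apply: Or44] => z Hz /=.
- by apply: (escapes_contra H _ (fr (k - z) _)) => //; rewrite /= in Hz; lia.
- by apply: (escapes_contra H _ (fr (k - z) _)) => //; rewrite /= in Hz; lia.
- by apply: (escapes_contra H _ (fr z Hz)); rewrite /flipx /=; congr pair; lia.
- by apply: (escapes_contra H _ (fr z Hz)); rewrite /flipx /=; congr pair; lia.
Qed.

Lemma iso_flipy k : cell_iso (flipy k) (flipy k).
Proof.
apply: iso_invol => [[x y]|[x y] [z w]|A [x y] fr H]; rewrite /flipy /=.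
- by congr pair; lia.
- by rewrite /adj /=; lia.
case: fr => /= fr; [apply: Or41|apply: Or42|apply: Or44|apply: Or43] => z Hz /=.
- by apply: (escapes_contra H _ (fr z Hz)); rewrite /flipy /=; congr pair; lia.
- by apply: (escapes_contra H _ (fr z Hz)); rewrite /flipy /=; congr pair; lia.
- by apply: (escapes_contra H _ (fr (k - z) _)) => //; rewrite /= in Hz; lia.
- by apply: (escapes_contra H _ (fr (k - z) _)) => //; rewrite /= in Hz; lia.
Qed.

Lemma iso_swap : cell_iso swap swap.
Proof.
apply: iso_invol => [[x y]|[x y] [z w]|A [x y] fr H]; rewrite /swap //=.
- by rewrite /adj /=; lia.
case: fr => /= fr; [apply: Or43|apply: Or44|apply: Or41|apply: Or42] => z Hz /=;
  by apply: (escapes_contra H _ (fr z Hz)).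
Qed.

(** * The side count *)

Definition cols (A : tileset) : {fset int} := [fset c.1 | c in A].
Definition rows (A : tileset) : {fset int} := [fset c.2 | c in A].

Definition north : cell := (0, 1).
Definition south : cell := (0, - 1).
Definition east : cell := (1, 0).
Definition west : cell := (- 1, 0).

Definition inner (A : tileset) (e : cell) : tileset :=
  [fset c in A | (c.1 + e.1, c.2 + e.2) \in A].
Definition exposed (A : tileset) (e : cell) : tileset :=
  [fset c in A | (c.1 + e.1, c.2 + e.2) \notin A].

Lemma mem_exposed A e c :
  (c \in exposed A e) = (c \in A) && ((c.1 + e.1, c.2 + e.2) \notin A).
Proof. by rewrite !inE. Qed.

Lemma card_inner_exposed A e : (#|` inner A e| + #|` exposed A e| = #|` A|)%N.
Proof.
rewrite -(cardfsID (inner A e) A); congr (_ + _)%N; congr (#|` _|);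
  by apply/fsetP => c; rewrite !inE; case: (c \in A); rewrite /= ?andbT ?andbF.
Qed.

Lemma fset_argmin (H : {fset cell}) (phi : cell -> int) : H != fset0 ->
  exists2 b, b \in H & forall c, c \in H -> phi b <= phi c.
Proof.
move/fset0Pn => [c0 c0H].
suff main (s : seq cell) c : c \in s ->
    exists2 b, b \in s & forall c, c \in s -> phi b <= phi c.
  exact: (main (enum_fset H) c0).
elim: s c => // x [|y s] IH _ _.
  by exists x; rewrite ?inE // => c /[1!inE] /eqP ->.
have [b bs bm] := IH y (mem_head _ _).
have [le|lt] := lerP (phi x) (phi b).
  exists x; first exact: mem_head.
  by move=> c; rewrite inE => /predU1P[->//|/bm]; apply: le_trans.
exists b; first by rewrite inE bs orbT.
by move=> c; rewrite inE => /predU1P[->|/bm//]; apply: ltW.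
Qed.

Lemma hole_eq A H H' c : hole A H -> hole A H' -> c \in H -> c \in H' -> H = H'.
Proof.
move=> [_ _ cl co] [_ _ cl' co'] cH cH'; apply/fsetP => d; apply/idP/idP => dH.
  by apply: cl' cH' _; apply: co.
by apply: cl cH _; apply: co'.
Qed.

(** The tile under the lowest cell of a hole is exposed to that hole, and the topmost tile of a
    column is exposed to a cell that escapes upwards, so it faces no hole. The two kinds of tiles
    are therefore disjoint ([V] and its complement in [U]). *)
Lemma exposed_up A h : num_holes A h ->
  (h + #|` cols A| <= #|` exposed A north|)%N.
Proof.
move=> [s [us <- hs]]; set U := exposed _ _.
pose up (c : cell) : cell := (c.1 + 0, c.2 + 1).
pose V := [fset c in U | has (fun H : {fset cell} => up c \in H) s].
have HU H : H \in s -> exists2 c, c \in V & up c \in H.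
  move=> Hs; have hH := (hs H).2 Hs; have [H0 HA cl _] := hH.
  have [[x y] bH bm] := fset_argmin (fun c : cell => c.2) H0.
  have upb : up (x, y - 1) = (x, y) by rewrite /up /=; congr pair; lia.
  exists (x, y - 1); last by rewrite upb.
  rewrite !inE -/(up _) upb (HA _ bH) andbT.
  have -> /= : (x, y - 1) \in A.
    apply: contraT => bA; have /bm /= : (x, y - 1) \in H; last by lia.
    apply: (cl _ _ bH); apply: (@link1 (fun c => c \notin A)) => //; first exact: HA.
    by rewrite /adj /=; lia.
  by apply/hasP; exists H; rewrite ?upb.
have -> : #|` U| = (#|` V| + #|` U `\` V|)%N.
  rewrite -[LHS](cardfsID V U); congr (_ + _)%N; congr (#|` _|).
  by apply/fsetP => c; rewrite !inE; case: (c \in A); rewrite /= ?andbF // andbA andbb.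
apply: leq_add.
  (* [g] sends a tile of [V] to the hole above it. It is onto [s], because two holes sharing a cell
     are equal. *)
  pose g (c : cell) := nth fset0 s (find (fun H : {fset cell} => up c \in H) s).
  rewrite -(size_map g V); apply: uniq_leq_size => // H Hs.
  have [c cV cH] := HU H Hs; apply/mapP; exists c => //.
  have hc : has (fun H : {fset cell} => up c \in H) s by apply/hasP; exists H.
  apply: (hole_eq _ _ cH (nth_find fset0 hc)); apply/hs => //.
  by rewrite mem_nth // -has_find.
have sub : cols A `<=` [fset c.1 | c in U `\` V].
  apply/fsubsetP => x /imfsetP[[x' y] /= xyA ->].
  have C0 : [fset c in A | c.1 == x'] != fset0.
    by apply/fset0Pn; exists (x', y); rewrite !inE xyA /=.
  have [[x1 y1]] := fset_argmin (fun c : cell => - c.2) C0.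
  rewrite !inE /= => /andP[bA /eqP E] bm; subst x1; apply/imfsetP; exists (x', y1) => //=.
  have above z : y1 < z -> (x', z) \notin A.
    move=> Hz; apply/negP => zA; have := bm (x', z); rewrite !inE zA eqxx /=; lia.
  have x0 : x' + 0 = x' by lia.
  rewrite !inE /= x0 bA above /= ?andbT; last by lia.
  apply/hasPn => H /hs hH.
  apply: (escapes_nohole _ hH); apply: Or43 => /= z Hz; rewrite /up /= in Hz *.
  by rewrite x0 above //; lia.
apply: leq_trans (fsubset_leq_card sub) _; exact: leq_imfset_card.
Qed.

Lemma exposed_iso f g A e e' : cell_iso f g ->
  (forall c, f (c.1 + e.1, c.2 + e.2) = ((f c).1 + e'.1, (f c).2 + e'.2)) ->
  #|` exposed (f @` A) e'| = #|` exposed A e|.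
Proof.
move=> fg fe; rewrite -[RHS](card_iso fg); congr (#|` _|); apply/fsetP => c.
by rewrite -(isoVK fg c) (mem_isof fg) !mem_exposed -fe !(mem_isof fg).
Qed.

Lemma cols_swap A : cols (swap @` A) = rows A.
Proof.
apply/fsetP => x; apply/imfsetP/imfsetP => -[c cA ->].
  by exists (swap c) => //=; rewrite (mem_iso iso_swap) in cA.
by exists (swap c) => //=; rewrite (mem_isof iso_swap).
Qed.

Lemma cols_flipy k A : cols (flipy k @` A) = cols A.
Proof.
apply/fsetP => x; apply/imfsetP/imfsetP => -[c cA ->].
  by exists (flipy k c) => //=; rewrite (mem_iso (iso_flipy k)) in cA.
by exists (flipy k c) => //=; rewrite (mem_isof (iso_flipy k)).
Qed.

Lemma exposed_down A h : num_holes A h ->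
  (h + #|` cols A| <= #|` exposed A south|)%N.
Proof.
have i := iso_flipy 0; move/(num_holes_iso i i)/exposed_up.
rewrite cols_flipy (exposed_iso (e := south) A i) // => -[x y].
by rewrite /flipy /=; congr pair; lia.
Qed.

Lemma exposed_sides A h : num_holes A h ->
  (h + #|` rows A| <= #|` exposed A east|)%N /\
  (h + #|` rows A| <= #|` exposed A west|)%N.
Proof.
have i := iso_swap; move/(num_holes_iso i i) => H.
have := (exposed_up H, exposed_down H); rewrite cols_swap.
rewrite (exposed_iso (e := east) A i) // (exposed_iso (e := west) A i) //.
by case.
Qed.

Definition edges (A : tileset) (E : rel cell) : {fset cell * cell} :=
  [fset p in A `*` A | E p.1 p.2].

(** Grow a connected set from [r] one cell at a time: each new cell brings one edge, counted in both
    directions. Connectivity is given as an induction principle over predicates, so that it can be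
    checked after deleting some adjacencies without exhibiting chains. *)
Lemma card_edges_connected (A : tileset) (E : rel cell) (r : cell) :
  symmetric E -> r \in A -> irreflexive E ->
  (forall Q : pred cell, Q r ->
     (forall c d, c \in A -> d \in A -> E c d -> Q c -> Q d) ->
     forall d, d \in A -> Q d) ->
  (2 * #|` A| <= #|` edges A E| + 2)%N.
Proof.
move=> Es rA Ei cut.
have main k : (0 < k <= #|` A|)%N -> exists S : tileset,
    [/\ S `<=` A, r \in S, #|` S| = k & (2 * k <= #|` edges S E| + 2)%N].
  elim: k => // -[_ _|k IH kA].
    by exists [fset r]; rewrite fsub1set cardfs1 inE; split=> //; lia.
  have [|S [SA rS Sk le]] := IH; first by lia.
  have [c [d [cS dA dS cd]]] : exists c d, [/\ c \in S, d \in A, d \notin S & E c d].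
  - have : ~~ (A `<=` S) by apply/negP => /fsubset_leq_card; lia.
    move/fsubsetPn => [z zA zS].
    (* If no edge left [S], membership in [S] would be stable along [E], and [cut] would put [z] in
       [S]. *)
    pose b := [exists p : A * A, [&& val p.1 \in S, val p.2 \notin S & E (val p.1) (val p.2)]].
    have [/existsP[[c d] /= /and3P[cS dS cd]]|/existsPn nb] := boolP b.
      by exists (val c), (val d); split=> //; apply: valP.
    suff : z \in S by rewrite (negbTE zS).
    apply: (cut (fun c => c \in S)) => // c d cA dA cd cS; apply: contraT => dS.
    by have := nb ([` cA], [` dA]); rewrite /= cS dS cd.
  exists (d |` S); split.
  - by rewrite fsubUset fsub1set dA.
  - by rewrite !inE rS orbT.
  - by rewrite cardfsU1 dS Sk.
  have sub : (c, d) |` ((d, c) |` edges S E) `<=` edges (d |` S) E.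
    apply/fsubsetP => -[x y]; rewrite !inE /= !xpair_eqE.
    case/or3P=> [/andP[/eqP-> /eqP->]|/andP[/eqP-> /eqP->]|/andP[/andP[-> ->] ->]].
    + by rewrite cd cS eqxx orbT.
    + by rewrite Es cd cS eqxx orbT.
    + by rewrite !orbT.
  apply: leq_trans (leq_add (fsubset_leq_card sub) (leqnn 2)).
  rewrite !cardfsU1 !inE /= !xpair_eqE (negbTE dS) /= !andbF /=.
  have -> : (c == d) = false by apply: contraNF dS => /eqP <-.
  move: le; rewrite /=; set e := #|` edges S E|; lia.
have A0 : (0 < #|` A|)%N by rewrite cardfs_gt0; apply/fset0Pn; exists r.
have [|S [SA _ SA' le]] := main #|` A|; first by rewrite A0 leqnn.
have AS : S = A; last by rewrite AS in le.
by apply/eqP; rewrite eqEfcard SA SA' /=.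
Qed.

Lemma card_edges_adj A : (#|` edges A adj| <=
  #|` inner A north| + #|` inner A south| + (#|` inner A east| + #|` inner A west|))%N.
Proof.
pose st (e : cell) := [fset ((c, (c.1 + e.1, c.2 + e.2)) : cell * cell) | c in inner A e].
have ste e : (#|` st e| <= #|` inner A e|)%N by apply: leq_imfset_card.
apply: (@leq_trans #|` (st north `|` st south) `|` (st east `|` st west)|).
  apply/fsubset_leq_card/fsubsetP => -[[x y] [z w]]; rewrite !inE /= => /andP[/andP[xA zA] a].
  have inst e : z = x + e.1 -> w = y + e.2 -> ((x, y), (z, w)) \in st e.
    by move=> ze we; apply/imfsetP; exists (x, y); rewrite /= ?inE /= -ze -we // xA.
  have : [\/ z = x + 0 /\ w = y + 1, z = x + 0 /\ w = y + (- 1),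
             z = x + 1 /\ w = y + 0 | z = x + (- 1) /\ w = y + 0].
    move: a; rewrite /adj /= => a.
    have [?|[?|[?|?]]] : (z = x /\ w = y + 1) \/ (z = x /\ w = y - 1) \/
        (z = x + 1 /\ w = y) \/ (z = x - 1 /\ w = y) by lia.
    - by constructor 1; lia.
    - by constructor 2; lia.
    - by constructor 3; lia.
    - by constructor 4; lia.
  by case=> -[ze we]; [rewrite (inst north) | rewrite (inst south)
    | rewrite (inst east) | rewrite (inst west)]; rewrite ?orbT.
by do ![apply: leq_trans (leq_card_fsetU _ _).1 _ || apply: leq_add => //].
Qed.

(* Counting tile sides: [4 n] is at least the number of ordered adjacent pairs,
   plus 4 sides facing each hole, plus 2 outer sides per row and per column. *)
Lemma tile_bound_edges A h (E : rel cell) (l : {fset cell * cell}) (r : cell) :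
  symmetric E -> r \in A -> (forall c d, E c d -> adj c d) ->
  (forall Q : pred cell, Q r ->
     (forall c d, c \in A -> d \in A -> E c d -> Q c -> Q d) ->
     forall d, d \in A -> Q d) ->
  (forall p, p \in l -> [/\ p.1 \in A, p.2 \in A, adj p.1 p.2 & ~~ E p.1 p.2]) ->
  num_holes A h ->
  (2 * (2 * h + #|` cols A| + #|` rows A|) + #|` l| <= 2 * #|` A| + 2)%N.
Proof.
move=> Es rA Ea cut hl nh.
have Ei : irreflexive E.
  by move=> c; apply: contraTF isT => /Ea; rewrite /adj !subrr.
have con := card_edges_connected Es rA Ei cut.
(* The pairs of [l] are adjacent but not related by [E], so they come on top of the edges that
   connectivity along [E] already forces. *)
have sub : edges A E `|` l `<=` edges A adj.
  apply/fsubsetP => -[c d]; rewrite !inE /= => /orP[/andP[->]/Ea->//|/hl /=].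
  by case=> -> -> ->.
have dj : [disjoint edges A E & l].
  apply/fdisjointP => p; rewrite !inE => /andP[_ pE]; apply/negP => /hl [_ _ _].
  by rewrite pE.
have := fsubset_leq_card sub; rewrite cardfsU; move/eqP: dj => ->; rewrite cardfs0.
have := card_edges_adj A; have := exposed_up nh; have := exposed_down nh.
have [] := exposed_sides nh.
have := (card_inner_exposed A north, card_inner_exposed A south).
have := (card_inner_exposed A east, card_inner_exposed A west).
by move=> [? ?] [? ?]; lia.
Qed.

Lemma tile_bound A h : polyomino A -> num_holes A h ->
  (2 * h + #|` cols A| + #|` rows A| <= #|` A| + 1)%N.
Proof.
move=> pA nh; have [r rA] := polyomino_nonempty pA.
have := @tile_bound_edges A h adj fset0 r adjC rA (fun _ _ => id) _ _ nh.
rewrite cardfs0 => H; suff : (2 * (2 * h + #|` cols A| + #|` rows A|) + 0 <= 2 * #|` A| + 2)%N by lia.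
apply: H => [Q Qr Qs d dA|p]; last by rewrite inE.
exact: (polyomino_ind (Q := Q) pA rA).
Qed.

(** * One cell per hole in a box *)

Definition rect (N M : nat) : tileset :=
  seq_fset tt [seq ((i%:Z, j%:Z) : cell) | i <- iota 0 N, j <- iota 0 M].

Lemma mem_rect N M (c : cell) : (c \in rect N M) =
  [&& 0 <= c.1, c.1 < N%:Z, 0 <= c.2 & c.2 < M%:Z].
Proof.
rewrite seq_fsetE; apply/allpairsP/idP => [[[i j] /= []]|/and4P[]].
  by rewrite !mem_iota => ? ? -> /=; lia.
case: c => x y /= *; exists (`|x|%N, `|y|%N); rewrite /= !mem_iota.
by split; try congr pair; lia.
Qed.

Lemma card_rect N M : #|` rect N M| = (N * M)%N.
Proof.
rewrite size_seq_fset undup_id; first by rewrite size_allpairs !size_iota.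
by apply: allpairs_uniq; rewrite ?iota_uniq // => -[i j] [k l] _ _ /= [-> ->].
Qed.

Definition interior (N M : nat) (c : cell) : bool :=
  [&& 0 < c.1, c.1 + 1 < N%:Z, 0 < c.2 & c.2 + 1 < M%:Z].

Definition sparse (N M : nat) (R : {fset cell}) : Prop :=
  (forall r, r \in R -> interior N M r) /\
  (forall r d, r \in R -> d \in R -> ~~ adj r d).

(** The normal form of a polyomino in a box: every hole shrunk to one interior cell and all other
    cells of the box filled. The border is then always a full ring of tiles. *)
Definition config (N M : nat) (R : {fset cell}) : Prop :=
  sparse N M R /\ polyomino (rect N M `\` R).

Definition corner (N M : nat) (c : cell) : bool :=
  ((c.1 == 0) || (c.1 + 1 == N%:Z)) && ((c.2 == 0) || (c.2 + 1 == M%:Z)).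

(** A corner is not adjacent to any interior cell, so cutting corners opens no hole, and a cut
    corner escapes along its row. *)
Lemma sparse_pits N M R (K : {fset cell}) : sparse N M R ->
  (forall k, k \in K -> corner N M k) -> pits (rect N M `\` R `\` K) R.
Proof.
move=> [Ri Ra] Kc; split.
- by move=> r rR; rewrite !inE rR /= andbF.
- move=> r d rR rd; have di := Ri _ rR; rewrite !inE.
  have -> /= : d \notin K.
    by apply: contraL rd => /Kc; move: di; rewrite /corner /interior /adj; lia.
  have -> /= : d \notin R by apply: contraL rd => /(Ra _ _ rR).
  by rewrite mem_rect; move: di rd; rewrite /interior /adj; lia.
move=> [x y]; rewrite !inE => cA cR; rewrite (negbTE cR) /= in cA.
have out z w : (z, w) \notin rect N M -> (z, w) \notin rect N M `\` R `\` K.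
  by apply: contra; rewrite !inE => /and3P[].
have [cK|cK] := boolP ((x, y) \in K); last first.
  rewrite cK /= mem_rect /= in cA.
  have [|[|[|]]] : x < 0 \/ N%:Z <= x \/ y < 0 \/ M%:Z <= y by lia.
  - by move=> ?; apply: Or42 => z /= ?; apply: out; rewrite mem_rect /=; lia.
  - by move=> ?; apply: Or41 => z /= ?; apply: out; rewrite mem_rect /=; lia.
  - by move=> ?; apply: Or44 => z /= ?; apply: out; rewrite mem_rect /=; lia.
  - by move=> ?; apply: Or43 => z /= ?; apply: out; rewrite mem_rect /=; lia.
have /andP[/= cx _] := Kc _ cK.
have cc : (x, y) \notin rect N M `\` R `\` K by rewrite !inE cK.
have [x0|x1] : x = 0 \/ x + 1 = N%:Z by lia.
- apply: Or42 => z /= zx; have [->//|zx'] := eqVneq z x.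
  by apply: out; rewrite mem_rect /=; lia.
- apply: Or41 => z /= zx; have [->//|zx'] := eqVneq z x.
  by apply: out; rewrite mem_rect /=; lia.
Qed.

Lemma config_pits N M R : config N M R -> pits (rect N M `\` R) R.
Proof.
move=> [sR _]; have := @sparse_pits N M R fset0 sR; rewrite fsetD0; apply=> k.
by rewrite inE.
Qed.

Definition border (N M : nat) (c : cell) : bool :=
  (c \in rect N M) && ~~ interior N M c.

(** A ring with one cell removed is still a path. The root is the opposite corner, from which the
    two arms reach everything but (0, 0). *)
Lemma border_link (P : pred cell) N M : (1 < N)%N -> (1 < M)%N ->
  (forall c, border N M c -> c != (0, 0) -> P c) ->
  forall c, border N M c -> c != (0, 0) -> link P (N%:Z - 1, M%:Z - 1) c.
Proof.
move=> N1 M1 HP [x y] b; rewrite xpair_eqE => c0.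
have P' z w : border N M (z, w) -> ~ (z = 0 /\ w = 0) -> P (z, w).
  by move=> bz zw; apply: HP => //; rewrite xpair_eqE; lia.
have top z : 0 <= z -> z < N%:Z -> link P (N%:Z - 1, M%:Z - 1) (z, M%:Z - 1).
  move=> *; apply/link_sym/link_hseg; first lia.
  by move=> u *; apply: P'; rewrite /border ?mem_rect /interior /=; lia.
have right w : 0 <= w -> w < M%:Z -> link P (N%:Z - 1, M%:Z - 1) (N%:Z - 1, w).
  move=> *; apply/link_sym/link_vseg; first lia.
  by move=> u *; apply: P'; rewrite /border ?mem_rect /interior /=; lia.
move: b; rewrite /border mem_rect /interior /= => b.
have [->|[->|[x0|y0]]] : x = N%:Z - 1 \/ y = M%:Z - 1 \/ x = 0 \/ y = 0 by lia.
- by apply: right; lia.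
- by apply: top; lia.
- rewrite x0 in c0 *; apply: (link_trans (top 0 _ _)); [lia..|].
  apply/link_sym/link_vseg; first lia.
  by move=> u *; apply: P'; rewrite /border ?mem_rect /interior /=; lia.
- rewrite y0 in c0 *; apply: (link_trans (right 0 _ _)); [lia..|].
  apply/link_sym/link_hseg; first lia.
  by move=> u *; apply: P'; rewrite /border ?mem_rect /interior /=; lia.
Qed.

Lemma border_link_full (P : pred cell) N M : (1 < N)%N -> (1 < M)%N ->
  (forall c, border N M c -> P c) ->
  forall c, border N M c -> link P (N%:Z - 1, M%:Z - 1) c.
Proof.
move=> N1 M1 HP c b; have bl := border_link N1 M1 (fun c b _ => HP c b).
have [->|c0] := eqVneq c (0, 0); last exact: bl.
have b1 : border N M (1, 0) by rewrite /border mem_rect /interior /=; lia.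
apply: (link_trans (bl (1, 0) b1 isT)); apply: link1; [exact: HP| |by []].
by apply: HP; rewrite /border mem_rect /interior /=; lia.
Qed.

(** * From an arbitrary polyomino in a box to a configuration *)

Section Normalize.
Variables (N M : nat) (A : tileset) (R : {fset cell}).
Hypotheses (N1 : (1 < N)%N) (M1 : (1 < M)%N).
Hypotheses (pA : polyomino A) (Arect : in_rect N M A).
Hypothesis Ri : forall r, r \in R -> interior N M r.
Hypothesis RA : forall r, r \in R -> r \notin A.
Hypothesis Rescapes : forall r, r \in R -> ~ escapes A r.
Hypothesis Rlink : forall r d, r \in R -> d \in R -> reach_out A r d -> r = d.

Let B := rect N M `\` R.
Let base : cell := (N%:Z - 1, M%:Z - 1).

Let border_base c : border N M c -> lk B base c.
Proof.
apply: border_link_full => // {}c /andP[c1 c2]; rewrite !inE c1 andbT.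
by apply: contra c2 => /Ri.
Qed.

Let subAB c : c \in A -> c \in B.
Proof.
move=> cA; rewrite !inE mem_rect Arect // andbT.
by apply: contraL cA => /RA.
Qed.

(** Above a topmost tile there is neither a tile of [A] nor a cell of [R], since cells of [R] do not
    escape; so the vertical segment up to the border lies in [B]. Connectivity of [A] carries the
    link to all its tiles. *)
Let tile_base c : c \in A -> lk B base c.
Proof.
move=> cA; have [A0 _] := pA.
have [[x y] tA tm] := fset_argmin (fun c : cell => - c.2) A0.
have t0 : lk B base (x, y).
  have /and4P[/= ? ? ? ?] := Arect tA.
  apply: (link_trans (d := (x, M%:Z - 1))).
    by apply: border_base; rewrite /border mem_rect /interior /=; lia.
  apply/link_sym/link_vseg; first lia.
  move=> w Hw1 Hw2; have [->|wy] := eqVneq w y; first exact: subAB.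
  rewrite !inE mem_rect /=; apply/andP; split; last lia.
  apply/negP => /Rescapes; apply; apply: Or43 => /= z Hz; apply/negP => /tm /=; lia.
apply: (link_trans t0); apply: (link_sub _ (polyomino_link pA tA cA)).
exact: subAB.
Qed.

Let upward (k : nat) (x y : int) : (x, y) \in B -> y + k%:Z = M%:Z - 1 ->
  lk B base (x, y) \/
  exists r, [/\ r \in R, y < r.2 & reach_out A (x, y) r].
Proof.
elim: k y => [|k IH] y cB yk.
  left; apply: border_base; move: cB; rewrite /border /interior !inE mem_rect /=.
  by lia.
have [cA|cA] := boolP ((x, y) \in A); first by left; apply: tile_base.
have a : adj (x, y) (x, y + 1) by rewrite /adj /=; lia.
have [dR|dR] := boolP ((x, y + 1) \in R).
  right; exists (x, y + 1); split=> //=; first lia.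
  by apply: (@link1 (fun c => c \notin A)) => //; apply: RA.
have dB : (x, y + 1) \in B.
  by move: cB; rewrite !inE dR !mem_rect /=; lia.
have [|L|[r [rR lt L]]] := IH _ dB; first by lia.
  by left; apply: (link_trans L); apply: link1; rewrite // adjC.
right; exists r; split=> //; first lia.
have [_ dA] := link_in (link_sym (P := fun c => c \notin A) L).
by apply: link_trans L; apply: (@link1 (fun c => c \notin A)).
Qed.

Let downward (k : nat) (x y : int) : (x, y) \in B -> y = k%:Z ->
  lk B base (x, y) \/
  exists r, [/\ r \in R, r.2 < y & reach_out A (x, y) r].
Proof.
elim: k y => [|k IH] y cB yk.
  left; apply: border_base; move: cB; rewrite /border /interior !inE mem_rect /=.
  by lia.
have [cA|cA] := boolP ((x, y) \in A); first by left; apply: tile_base.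
have a : adj (x, y) (x, y - 1) by rewrite /adj /=; lia.
have [dR|dR] := boolP ((x, y - 1) \in R).
  right; exists (x, y - 1); split=> //=; first lia.
  by apply: (@link1 (fun c => c \notin A)) => //; apply: RA.
have dB : (x, y - 1) \in B.
  by move: cB; rewrite !inE dR !mem_rect /=; lia.
have [|L|[r [rR lt L]]] := IH _ dB; first by lia.
  by left; apply: (link_trans L); apply: link1; rewrite // adjC.
right; exists r; split=> //; first lia.
have [_ dA] := link_in (link_sym (P := fun c => c \notin A) L).
by apply: link_trans L; apply: (@link1 (fun c => c \notin A)).
Qed.

(* A cell of [B] reaches the border or a tile of [A] by moving up or down:
   both ways cannot be blocked by [R], as the two blocking cells would belong
   to the same hole. *)
Lemma config_representatives : config N M R.
Proof.
split.
  split=> // r d rR dR; apply/negP => rd.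
  have E : r = d.
    apply: Rlink => //.
    by apply: (@link1 (fun c => c \notin A)) => //; apply: RA.
  by move: rd; rewrite E /adj !subrr.
have bb : base \in B.
  have /border_base/link_in[] // : border N M base.
  by rewrite /border mem_rect /interior /=; lia.
apply: (polyomino_root (r := base)) => // -[x y] cB.
have /andP[_] : ((x, y) \notin R) && ((x, y) \in rect N M) by move: cB; rewrite !inE.
rewrite mem_rect => /and4P[/= ? ? ? ?].
have [|//|[r [rR lt L]]] := @upward (absz (M%:Z - 1 - y)%R) x y cB; first by lia.
have [|//|[d [dR lt' L']]] := @downward (absz y) x y cB; first by lia.
have E : r = d.
  by apply: Rlink => //; apply: (link_trans (link_sym (P := fun c => c \notin A) L)).
by move: lt lt'; rewrite E; lia.
Qed.
End Normalize.

(** Any choice of one cell per hole works: such a cell does not escape, hence is interior to the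
    box, and two chosen cells in one component of the complement come from the same hole. *)
Lemma config_of_polyomino N M A h : polyomino A -> in_rect N M A ->
  num_holes A h -> (0 < h)%N -> exists2 R, config N M R & #|` R| = h.
Proof.
move=> pA Ar [s [us ss hs]] h0.
pose rep (H : {fset cell}) : cell := head (0, 0) (enum_fset H).
have repH H : hole A H -> rep H \in H.
  case=> /fset0Pn[c cH] _ _ _; rewrite /rep; have : c \in enum_fset H by [].
  suff main (t : seq cell) : c \in t -> head (0, 0) t \in t by apply: main.
  by case: t => //= a t _; rewrite mem_head.
pose R := [fset rep H | H in s].
have RP r : r \in R -> exists2 H, hole A H & r = rep H.
  by case/imfsetP => H /= /hs hH ->; exists H.
have RA r : r \in R -> r \notin A.
  by case/RP => H hH ->; have [_ HA _ _] := hH; apply/HA/repH.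
have Rescapes r : r \in R -> ~ escapes A r.
  by case/RP => H hH -> /escapes_nohole/(_ hH); rewrite repH.
have Rlink r d : r \in R -> d \in R -> reach_out A r d -> r = d.
  case/RP => H hH -> /RP[H' hH' ->] L; congr rep.
  apply: (hole_eq hH hH' _ (repH _ hH')); have [_ _ cl _] := hH.
  by apply: cl L; apply: repH.
have Ri r : r \in R -> interior N M r.
  move=> rR; have ne := Rescapes _ rR; have nA := RA _ rR.
  case: r {rR} ne nA => x y ne nA; apply/and4P; split=> /=.
  - rewrite ltNge; apply/negP => x0; apply: ne; apply: Or42 => /= z zx.
    have [->//|?] := eqVneq z x; apply/negP => /Ar /=; lia.
  - rewrite ltNge; apply/negP => x0; apply: ne; apply: Or41 => /= z zx.
    have [->//|?] := eqVneq z x; apply/negP => /Ar /=; lia.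
  - rewrite ltNge; apply/negP => x0; apply: ne; apply: Or44 => /= z zx.
    have [->//|?] := eqVneq z y; apply/negP => /Ar /=; lia.
  - rewrite ltNge; apply/negP => x0; apply: ne; apply: Or43 => /= z zx.
    have [->//|?] := eqVneq z y; apply/negP => /Ar /=; lia.
have cR : #|` R| = h.
  rewrite card_in_imfset /= ?undup_id // => H H' /hs hH /hs hH' E.
  by apply: (hole_eq hH hH' (repH _ hH)); rewrite E repH.
exists R => //.
have [r /Ri ir] : exists r, r \in R by apply/fset0Pn; rewrite -cardfs_gt0 cR.
by apply: (config_representatives (A := A)) => //; move: ir; rewrite /interior; lia.
Qed.

Lemma card_int_range (F : {fset int}) (a : int) (n : nat) :
  (forall x, a <= x -> x < a + n%:Z -> x \in F) -> (n <= #|` F|)%N.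
Proof.
move=> H; rewrite -[n in (n <= _)%N](size_iota 0) -(size_map (fun i : nat => a + i%:Z)).
apply: uniq_leq_size; first by rewrite map_inj_uniq ?iota_uniq // => i j; lia.
by move=> x /mapP[i]; rewrite mem_iota => ? ->; apply: H; lia.
Qed.

Lemma sparse_sub N M R : sparse N M R -> R `<=` rect N M.
Proof.
case=> Ri _; apply/fsubsetP => r /Ri; rewrite mem_rect /interior; lia.
Qed.

Lemma card_board N M R (K : {fset cell}) : sparse N M R ->
  (forall k, k \in K -> border N M k) ->
  (#|` rect N M `\` R `\` K| + #|` R| + #|` K| = N * M)%N.
Proof.
move=> sR Kb; have sub := sparse_sub sR.
have sK : K `<=` rect N M `\` R.
  apply/fsubsetP => k /Kb /andP[k1 k2]; rewrite !inE k1 andbT.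
  by apply: contra k2 => /sR.1.
rewrite (cardfsDS sK) (cardfsDS sub) card_rect.
have := fsubset_leq_card sub; have := fsubset_leq_card sK.
rewrite (cardfsDS sub) card_rect; move: #|` K| #|` R| (N * M)%N => *; lia.
Qed.

Lemma config_bases N M R : config N M R -> R != fset0 -> (2 < N)%N /\ (2 < M)%N.
Proof. by move=> [[Ri _] _] /fset0Pn[r /Ri]; rewrite /interior; lia. Qed.

Lemma config_border N M R c : config N M R -> border N M c -> c \in rect N M `\` R.
Proof.
move=> [[Ri _] _] /andP[c1 c2]; rewrite !inE c1 andbT.
by apply: contra c2 => /Ri.
Qed.

Lemma cutcorner N M R : (1 < N)%N -> (1 < M)%N -> config N M R ->
  polyomino (rect N M `\` R `\ (0, 0)).
Proof.
move=> N1 M1 cR; have [_ pA] := cR; have bA c := config_border (c := c) cR.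
apply: (polyomino_remove (r := (N%:Z - 1, M%:Z - 1)) pA).
- by apply: bA; rewrite /border mem_rect /interior /=; lia.
- by apply: bA; rewrite /border mem_rect /interior /=; lia.
- by rewrite xpair_eqE; lia.
move=> [x y] nA a; apply: (border_link N1 M1) => [c bc c0||].
- by rewrite in_fsetD1 c0 bA.
- move: nA a; rewrite in_fsetD mem_rect /border mem_rect /interior /adj /= => /andP[_].
  by lia.
- by move: a; rewrite /adj xpair_eqE /=; lia.
Qed.

Lemma corner00 N M : (0 < N)%N -> (0 < M)%N -> border N M (0, 0).
Proof. by move=> *; rewrite /border mem_rect /interior /=; lia. Qed.

Lemma config_bound N M R : config N M R -> R != fset0 ->
  (3 * #|` R| + 1 <= (N - 1) * (M - 1))%N.
Proof.
move=> cR R0; have [N2 M2] := config_bases cR R0; have [sR _] := cR.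
have pB : polyomino (rect N M `\` R `\ (0, 0)) by apply: cutcorner => //; lia.
have hK k : k \in [fset (0, 0)] -> corner N M k by rewrite inE => /eqP ->.
have pits := sparse_pits sR hK.
have := tile_bound pB (pits_num pits).
have hB k : k \in [fset (0, 0)] -> border N M k.
  by rewrite inE => /eqP ->; apply: corner00; lia.
have := card_board sR hB; rewrite cardfs1.
have top x y : 0 <= x -> x < N%:Z -> 0 <= y -> y < M%:Z ->
    ~~ (interior N M (x, y)) -> (x, y) != (0, 0) -> (x, y) \in rect N M `\` R `\ (0, 0).
  move=> x0 xN y0 yM bi c0; rewrite in_fsetD1 c0; apply: (config_border cR).
  by rewrite /border bi mem_rect /= x0 xN y0 yM.
set B := rect N M `\` R `\ (0, 0) in pB pits top *.
have : (N <= #|` cols B|)%N.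
  apply: (@card_int_range _ 0) => x x0 xN; apply/imfsetP.
  by exists (x, M%:Z - 1) => //; apply: top; rewrite ?xpair_eqE /interior /=; lia.
have : (M <= #|` rows B|)%N.
  apply: (@card_int_range _ 0) => x x0 xN; apply/imfsetP.
  by exists (N%:Z - 1, x) => //; apply: top; rewrite ?xpair_eqE /interior /=; lia.
move: #|` cols B| #|` rows B| #|` B| #|` R| => a b c d; nia.
Qed.

(** Without such a pair, uncovered cells would have to alternate with cells of [R] from the border
    cell 0 on, so every even position is uncovered. For even [N] the position [N - 2] is then
    uncovered next to the border cell [N - 1]. *)
Lemma uncovered_pair N M R (y : int) : config N M R -> ~~ odd N -> (0 < N)%N ->
  exists i : int, [/\ 0 <= i, i + 1 < N%:Z, (i, y) \notin R & (i + 1, y) \notin R].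
Proof.
move=> [[Ri Ra] _] Ne N0; pose T := exists i : int,
  [/\ 0 <= i, i + 1 < N%:Z, (i, y) \notin R & (i + 1, y) \notin R].
have out x : x <= 0 \/ N%:Z <= x + 1 -> (x, y) \notin R.
  by move=> H; apply/negP => /Ri; rewrite /interior /=; lia.
suff [//|[i [i0 iN iR]]] : T \/ exists i : int, [/\ 0 <= i, i + 2 = N%:Z & (i, y) \notin R].
  by exists i; split=> //; [lia|apply: out; lia].
have main (k : nat) : (2 * k + 2 <= N)%N -> T \/ (2 * k%:Z, y) \notin R.
  elim: k => [|k IH] kN; first by right; apply: out; lia.
  case: IH => [|//|IH]; [lia|by left|].
  have [oR|oR] := boolP ((2 * k%:Z + 1, y) \in R).
    right; apply: contraL (_ : adj (2 * k%:Z + 1, y) (2 * k.+1%:Z, y)) => [eR|].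
      exact: Ra.
    by rewrite /adj /=; lia.
  by left; exists (2 * k%:Z); split=> //; lia.
case: (main (N./2 - 1)%N); [lia|by left|move=> H].
by right; exists (2 * (N./2 - 1)%N%:Z); split=> //; lia.
Qed.

Definition edge (a b c d : cell) : bool :=
  ((c == a) && (d == b)) || ((c == b) && (d == a)).

Lemma edgeC a b c d : edge a b c d = edge a b d c.
Proof. by rewrite /edge orbC (andbC (c == a)) (andbC (c == b)). Qed.

(* The bottom and top edges lie in full 2 x 2 blocks, given by [uncovered_pair],
   and the left edge lies on the border cycle, so deleting all three keeps the
   tiles connected. *)
Definition cut_adj (M : nat) (i j : int) (c d : cell) : bool :=
  [&& adj c d, ~~ edge (i, 0) (i + 1, 0) c d,
      ~~ edge (j, M%:Z - 1) (j + 1, M%:Z - 1) c d & ~~ edge (0, 1) (0, 2) c d].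

Lemma cut_adjC M i j : symmetric (cut_adj M i j).
Proof. by move=> c d; rewrite /cut_adj adjC !(edgeC _ _ c d). Qed.

Lemma cut_adj_h M i j x y : y != 0 -> y != M%:Z - 1 ->
  cut_adj M i j (x, y) (x + 1, y).
Proof.
move=> y0 yM; rewrite /cut_adj /edge /adj !xpair_eqE (negbTE y0) (negbTE yM).
by rewrite !andbF /=; lia.
Qed.

Lemma cut_adj_v M i j x y : y != 1 -> cut_adj M i j (x, y) (x, y + 1).
Proof.
move=> y1; have H b z a : ~~ edge (a, z) (b, z) (x, y) (x, y + 1).
  by rewrite /edge !xpair_eqE; lia.
by rewrite /cut_adj !H /edge /adj !xpair_eqE /=; lia.
Qed.

(** The way round goes through the neighbouring row [w]. The hypothesis [3 < M] keeps it off all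
    deleted edges, in particular off the vertical edge from (0, 1) to (0, 2) when [v] is the top
    row. *)
Lemma detour (Q : pred cell) (A : tileset) M i j (x v w : int) :
  (forall c d, c \in A -> d \in A -> cut_adj M i j c d -> Q c = Q d) ->
  (v = 0 /\ w = 1) \/ (v = M%:Z - 1 /\ w = M%:Z - 2) -> (3 < M)%N ->
  (x, v) \in A -> (x + 1, v) \in A -> (x, w) \in A -> (x + 1, w) \in A ->
  Q (x, v) = Q (x + 1, v).
Proof.
move=> step vw M3 t1 t2 t3 t4.
have vE u : cut_adj M i j (u, v) (u, w).
  have [e|e] : w = v + 1 /\ v != 1 \/ v = w + 1 /\ w != 1 by lia.
    by case: e => -> e; apply: cut_adj_v.
  by case: e => -> e; rewrite cut_adjC; apply: cut_adj_v.
transitivity (Q (x, w)); first exact: step.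
transitivity (Q (x + 1, w)); first by apply: step => //; apply: cut_adj_h; lia.
by apply: step; rewrite // cut_adjC.
Qed.

Lemma border_arc N M : (1 < N)%N -> (3 < M)%N ->
  link (fun c => border N M c && (c != (0, 1))) (0, 0) (0, 2).
Proof.
move=> N1 M3; have b x y : 0 <= x -> x < N%:Z -> 0 <= y -> y < M%:Z ->
    [|| x == N%:Z - 1, y == 0, y == M%:Z - 1 | (x == 0) && (1 < y)] ->
    border N M (x, y) && ((x, y) != (0, 1)).
  by move=> *; rewrite /border mem_rect /interior xpair_eqE /=; lia.
apply: (link_trans (d := (N%:Z - 1, 0))).
  by apply: link_hseg => [|x *]; [|apply: b]; lia.
apply: (link_trans (d := (N%:Z - 1, M%:Z - 1))).
  by apply: link_vseg => [|x *]; [|apply: b]; lia.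
apply: (link_trans (d := (0, M%:Z - 1))); apply: link_sym.
  by apply: link_hseg => [|x *]; [|apply: b]; lia.
by apply: link_vseg => [|x *]; [|apply: b]; lia.
Qed.

Lemma cut_adj_connected (Q : pred cell) N M R i j : config N M R -> (1 < N)%N ->
  (3 < M)%N -> 0 <= i -> i + 1 < N%:Z -> (i, 1) \notin R -> (i + 1, 1) \notin R ->
  0 <= j -> j + 1 < N%:Z -> (j, M%:Z - 2) \notin R -> (j + 1, M%:Z - 2) \notin R ->
  Q (0, 0) ->
  (forall c d, c \in rect N M `\` R -> d \in rect N M `\` R ->
     cut_adj M i j c d -> Q c -> Q d) ->
  forall d, d \in rect N M `\` R -> Q d.
Proof.
move=> cR N1 M3 i0 iN i1 i2 j0 jN j1 j2 Q0 QE; set A := rect N M `\` R in QE *.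
have [_ pA] := cR.
have inA x y : (x, y) \in A = [&& (x, y) \notin R, 0 <= x, x < N%:Z, 0 <= y & y < M%:Z].
  by rewrite in_fsetD mem_rect.
have bA c : border N M c -> c \in A by apply: config_border.
have hb x y : 0 <= x -> x < N%:Z -> y = 0 \/ y = M%:Z - 1 -> border N M (x, y).
  by clear -M3 => *; rewrite /border mem_rect /interior /=; lia.
have vb x y : 0 <= y -> y < M%:Z -> x = 0 \/ x = N%:Z - 1 -> border N M (x, y).
  by clear -N1 => *; rewrite /border mem_rect /interior /=; lia.
have step c d : c \in A -> d \in A -> cut_adj M i j c d -> Q c = Q d.
  by move=> cA dA e; apply/idP/idP; apply: QE; rewrite // cut_adjC.
have Q1 : Q (i, 0) = Q (i + 1, 0).
  apply: (detour (w := 1) step) => //; first by left.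
  - by apply/bA/hb; [| |by left]; clear -i0 iN; lia.
  - by apply/bA/hb; [| |by left]; clear -i0 iN; lia.
  - by rewrite inA i1 /=; lia.
  - by rewrite inA i2 /=; lia.
have Q2 : Q (j, M%:Z - 1) = Q (j + 1, M%:Z - 1).
  apply: (detour (w := M%:Z - 2) step) => //; first by right.
  - by apply/bA/hb; [| |by right]; clear -j0 jN; lia.
  - by apply/bA/hb; [| |by right]; clear -j0 jN; lia.
  - by rewrite inA j1 /=; lia.
  - by rewrite inA j2 /=; lia.
(* The bottom and top edges are recovered first, because the long arc of the border that replaces
   the left edge may run through them. *)
have QA c d : c \in A -> d \in A -> adj c d -> ~~ edge (0, 1) (0, 2) c d -> Q c = Q d.
  move=> xA zA a n3.
  have [|n1] := boolP (edge (i, 0) (i + 1, 0) c d).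
    by rewrite /edge => /orP[/andP[/eqP-> /eqP->]|/andP[/eqP-> /eqP->]].
  have [|n2] := boolP (edge (j, M%:Z - 1) (j + 1, M%:Z - 1) c d).
    by rewrite /edge => /orP[/andP[/eqP-> /eqP->]|/andP[/eqP-> /eqP->]].
  by apply: step; rewrite // /cut_adj a n1 n2.
have seg c d : link (fun c => border N M c && (c != (0, 1))) c d -> Q c = Q d.
  move=> L; apply: (link_ind (Q := fun d => Q c = Q d) L) => // x y.
  move=> /andP[bx x1] /andP[by' y1] xy ->; apply: QA (bA _ bx) (bA _ by') xy _.
  by rewrite /edge (negbTE x1) (negbTE y1) andbF.
have Q3 : Q (0, 1) = Q (0, 2).
  transitivity (Q (0, 0)); last exact/seg/border_arc.
  by apply: QA => //; apply/bA/vb; try (by left); clear -M3; lia.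
have rA : (0, 0) \in A by apply/bA/hb; [|clear -N1; lia|left].
apply: (polyomino_ind (Q := Q) pA rA) => // c d cA dA cd Qc.
have [|n3] := boolP (edge (0, 1) (0, 2) c d); last by rewrite -(QA c d).
by move=> /orP[/andP[/eqP cE /eqP->]|/andP[/eqP cE /eqP->]]; rewrite cE -?Q3 ?Q3 in Qc *.
Qed.

(** Three adjacencies beyond what connectivity requires, that is six ordered pairs in [l], lower the
    right-hand side of the count by 3. No corner is cut here. *)
Lemma config_bound_even N M R : config N M R -> R != fset0 ->
  ~~ odd N -> (3 < M)%N -> (3 * #|` R| + 3 <= (N - 1) * (M - 1))%N.
Proof.
move=> cR R0 Ne M3; have [N2 _] := config_bases cR R0; have [sR pA] := cR.
have [|i [i0 iN i1 i2]] := uncovered_pair 1 cR Ne; first lia.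
have [|j [j0 jN j1 j2]] := uncovered_pair (M%:Z - 2) cR Ne; first lia.
have bA x y : 0 <= x -> x < N%:Z -> 0 <= y -> y < M%:Z ->
    ~~ (interior N M (x, y)) -> (x, y) \in rect N M `\` R.
  move=> x0 xN y0 yM bi; apply: (config_border cR).
  by rewrite /border bi mem_rect /= x0 xN y0 yM.
have rA : (0, 0) \in rect N M `\` R.
  by apply/(config_border cR)/corner00; clear -N2 M3; lia.
have N1 : (1 < N)%N by clear -N2; lia.
have cut Q := @cut_adj_connected Q N M R i j cR N1 M3 i0 iN i1 i2 j0 jN j1 j2.
pose l : seq (cell * cell) :=
  [:: ((i, 0), (i + 1, 0)); ((i + 1, 0), (i, 0));
      ((j, M%:Z - 1), (j + 1, M%:Z - 1)); ((j + 1, M%:Z - 1), (j, M%:Z - 1));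
      ((0, 1), (0, 2)); ((0, 2), (0, 1))].
have ul : uniq l.
  rewrite /= !inE !xpair_eqE; clear -M3; lia.
pose lf : {fset cell * cell} := seq_fset tt l.
have lE p : p \in lf ->
    [/\ p.1 \in rect N M `\` R, p.2 \in rect N M `\` R, adj p.1 p.2 & ~~ cut_adj M i j p.1 p.2].
  rewrite seq_fsetE => pl; rewrite !inE in pl.
  have t1 : (i, 0) \in rect N M `\` R by apply: bA; rewrite /interior /=; clear -i0 iN M3; lia.
  have t2 : (i + 1, 0) \in rect N M `\` R by apply: bA; rewrite /interior /=; clear -i0 iN M3; lia.
  have t3 : (j, M%:Z - 1) \in rect N M `\` R.
    by apply: bA; rewrite /interior /=; clear -j0 jN M3; lia.
  have t4 : (j + 1, M%:Z - 1) \in rect N M `\` R.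
    by apply: bA; rewrite /interior /=; clear -j0 jN M3; lia.
  have t5 : (0, 1) \in rect N M `\` R by apply: bA; rewrite /interior /=; clear -M3 N2; lia.
  have t6 : (0, 2) \in rect N M `\` R by apply: bA; rewrite /interior /=; clear -M3 N2; lia.
  case/or4P: pl => [|||/or3P[]] /eqP -> /=; split => //;
    first [by rewrite /adj /=; clear; lia | by rewrite /cut_adj /edge !eqxx ?orbT ?andbF].
have cl : #|` lf| = 6%N by rewrite size_seq_fset undup_id.
have Ea c d : cut_adj M i j c d -> adj c d by case/and4P.
have := tile_bound_edges (@cut_adjC M i j) rA Ea cut lE (pits_num (config_pits cR)).
have hB k : k \in fset0 -> border N M k by rewrite inE.
have := card_board sR hB; rewrite cardfs0 fsetD0 cl.
set A := rect N M `\` R in bA *.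
have : (N <= #|` cols A|)%N.
  apply: (@card_int_range _ 0) => x x0 xN; apply/imfsetP.
  by exists (x, 0) => //; apply: bA; rewrite /interior /=; clear -x0 xN M3; lia.
have : (M <= #|` rows A|)%N.
  apply: (@card_int_range _ 0) => x x0 xN; apply/imfsetP.
  by exists (0, x) => //; apply: bA; rewrite /interior /=; clear -x0 xN N2; lia.
move: #|` cols A| #|` rows A| #|` A| #|` R| => a b c d; clear -N2 M3; nia.
Qed.

(** * Growing a strip of three rows *)

Definition zigzag (w : nat) (T : int) : {fset cell} :=
  seq_fset tt [seq ((i%:Z, T + 1 + (odd i)%:Z) : cell) | i <- iota 1 (w - 1)].

Definition band (w : nat) (T : int) : tileset :=
  seq_fset tt [seq ((i%:Z, T + 1 + j%:Z) : cell) | i <- iota 0 w.+1, j <- iota 0 3].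

Lemma mem_zigzag w T (c : cell) : (c \in zigzag w T) =
  [&& 0 < c.1, c.1 < w%:Z & c.2 == T + 1 + (c.1 %% 2)%Z].
Proof.
rewrite seq_fsetE; apply/mapP/idP => [[i]|].
  by rewrite mem_iota => ? -> /=; lia.
case: c => x y /= *; exists (absz x); first by rewrite mem_iota; lia.
by congr pair; lia.
Qed.

Lemma card_zigzag w T : #|` zigzag w T| = (w - 1)%N.
Proof.
rewrite size_seq_fset undup_id ?size_map ?size_iota //.
by rewrite map_inj_uniq ?iota_uniq // => i j [].
Qed.

Lemma mem_band w T (c : cell) : (c \in band w T) =
  [&& 0 <= c.1, c.1 <= w%:Z, T + 1 <= c.2 & c.2 <= T + 3].
Proof.
rewrite seq_fsetE; apply/allpairsP/idP => [[[i j] []]|].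
  by rewrite !mem_iota => iw j3 ->; move: iw j3 => /=; lia.
case: c => x y H; exists (absz x, absz (y - T - 1)%R); rewrite !mem_iota.
by move: H => /= H; split; try congr pair; lia.
Qed.

Lemma card_band w T : #|` band w T| = (3 * w.+1)%N.
Proof.
rewrite size_seq_fset undup_id ?size_allpairs ?size_iota; first by rewrite mulnC.
by apply: allpairs_uniq; rewrite ?iota_uniq // => -[i j] [k l] _ _ /= [-> /addrI []->].
Qed.

(* Three new rows on top of the row [T], whose zigzag of holes is joined
   diagonally to the holes below by the hole [(1, T)]. *)
Definition grow (w : nat) (T : int) (A : tileset) : tileset :=
  (A `\ (1, T)) `|` (band w T `\` zigzag w T).

Definition grow_holes (w : nat) (T : int) (R : {fset cell}) : {fset cell} :=
  (1, T) |` (zigzag w T `|` R).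

Lemma mem_grow w T A x y : ((x, y) \in grow w T A) =
  ((x, y) \in A) && ~~ ((x == 1) && (y == T)) ||
  [&& 0 <= x, x <= w%:Z, T + 1 <= y, y <= T + 3 &
     ~~ [&& 0 < x, x < w%:Z & y == T + 1 + (x %% 2)%Z]].
Proof.
rewrite in_fsetU in_fsetD1 in_fsetD mem_band mem_zigzag xpair_eqE /=.
by rewrite andbC; congr orb; rewrite andbC -!andbA.
Qed.

(** Only the two top rows are constrained, so the bottom may be a box with cut corners or an opened
    hole. The tiles (0, T - 1) and (1, T - 1) provide the way round (1, T) once that tile becomes a
    hole. *)
Record growable (w : nat) (T : int) (A : tileset) (R : {fset cell}) : Prop := Growable {
  gr_poly : polyomino A;
  gr_pits : pits A R;
  gr_top : forall c : cell, c \in A -> c.2 <= T;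
  gr_row : forall x, 0 <= x -> x <= w%:Z -> (x, T) \in A;
  gr_left : (0, T - 1) \in A;
  gr_diag : (1, T - 1) \in A }.

Section Grow.
Variables (w : nat) (T : int) (A : tileset) (R : {fset cell}).
Hypotheses (w1 : (1 < w)%N) (gA : growable w T A R).

Let inA x y : (x, y) \in A -> ~ (x = 1 /\ y = T) -> (x, y) \in grow w T A.
Proof. by move=> xA n; rewrite mem_grow xA; lia. Qed.

Let strip x y : 0 <= x -> x <= w%:Z -> T + 1 <= y -> y <= T + 3 ->
  y = T + 3 \/ x = 0 \/ x = w%:Z \/ y <> T + 1 + (x %% 2)%Z -> (x, y) \in grow w T A.
Proof.
move=> x0 xw y0 y1 H; rewrite mem_grow; apply/orP; right.
by move: H w1 x0 xw y0 y1; clear; lia.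
Qed.

Let row x : 0 <= x -> x <= w%:Z -> x <> 1 -> (x, T) \in grow w T A.
Proof. by move=> x0 xw n; apply: inA; [exact: (gr_row gA)|case]. Qed.

Let above x y : T < y -> (x, y) \in A = false.
Proof. by move=> Ty; apply/negP => /(gr_top gA) /=; clear -Ty; lia. Qed.

Let left_column y : T <= y -> y <= T + 3 -> lk (grow w T A) (0, T) (0, y).
Proof.
move=> y0 y1; apply: link_vseg => // z z0 zy.
have [->|zT] := eqVneq z T; first by apply: row.
by apply: strip => //; [clear -z0 zT; lia|clear -zy y1; lia|right; left].
Qed.

Let top_row x : 0 <= x -> x <= w%:Z -> lk (grow w T A) (0, T) (x, T + 3).
Proof.
move=> x0 xw; apply: (link_trans (left_column (y := T + 3) _ _)); [clear; lia..|].
apply: link_hseg => // z z0 zx; apply: strip => //; [|clear; lia|by left].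
by apply: le_trans zx xw.
Qed.

Let right_column y : T <= y -> y <= T + 3 -> lk (grow w T A) (0, T) (w%:Z, y).
Proof.
move=> y0 y1; apply: (link_trans (top_row (x := w%:Z) _ _)) => //.
apply/link_sym/link_vseg => // z zy z3.
have [->|zT] := eqVneq z T; first by apply: row; move: w1; clear; lia.
by apply: strip => //; [clear -zy y0 zT; lia|right; right; left].
Qed.

(** Turning (1, T) into a hole may separate (2, T) from (0, T); the left column, top row and right
    column of the new strip form a loop that joins them again. *)
Let old_tile c : c \in A -> c != (1, T) -> lk (grow w T A) (0, T) c.
Proof.
have w0 : 1 <= w%:Z by move: w1; clear; lia.
have tA : (1, T) \in A by apply: (gr_row gA).
apply: (link_exchange (gr_poly gA) tA) => [[x y] cA|[x y] nA].
  by rewrite xpair_eqE => ct; apply: inA => // -[x1 yT]; rewrite x1 yT !eqxx in ct.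
rewrite /adj /= => a; have yT := gr_top gA nA; rewrite /= in yT.
have [[-> ->]|[[-> ->]|[-> ->]]] : x = 0 /\ y = T \/ x = 1 /\ y = T - 1 \/
    x = 2 /\ y = T by clear -a yT; lia.
- by apply: left_column; clear; lia.
- apply: (link_trans (d := (0, T - 1))); apply: link1.
  + by apply: row.
  + by apply: inA; [exact: (gr_left gA)|case].
  + by rewrite /adj /=; clear; lia.
  + by apply: inA; [exact: (gr_left gA)|case].
  + by apply: inA; [exact: (gr_diag gA)|clear; lia].
  + by rewrite /adj /=; clear; lia.
- apply: (link_trans (right_column (y := T) _ _)); [clear; lia..|].
  apply/link_sym/link_hseg; first by move: w1; clear; lia.
  by move=> x' *; apply: row => //; lia.
Qed.

Lemma polyomino_grow : polyomino (grow w T A).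
Proof.
have w0 : 2 <= w%:Z by move: w1; clear; lia.
have rA : (0, T) \in grow w T A by apply: row.
apply: (polyomino_root rA) => -[x y] cG.
have [cA|cA] := boolP ((x, y) \in A).
  apply: old_tile => //; rewrite xpair_eqE; apply/negP => /andP[/eqP x1 /eqP yT].
  by move: cG; rewrite mem_grow x1 yT !eqxx andbF /=; clear; lia.
have := cG; rewrite mem_grow (negbTE cA) /= => cB.
have [x0|x0] := eqVneq x 0; first by rewrite x0; apply: left_column; clear -cB; lia.
have [xw|xw] := eqVneq x w%:Z; first by rewrite xw; apply: right_column; clear -cB; lia.
have [y3|y3] := eqVneq y (T + 3); first by rewrite y3; apply: top_row; clear -cB; lia.
have [[ye xo]|[ye xo]] : y = T + 2 /\ (x %% 2)%Z = 0 \/ y = T + 1 /\ (x %% 2)%Z = 1.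
  by clear -cB x0 xw y3; lia.
- apply: (link_trans (top_row (x := x) _ _)); [clear -cB; lia..|].
  apply: link1 => //; last by rewrite ye /adj /=; clear; lia.
  by apply: strip; [clear -cB; lia..|left].
(* The tile (1, T + 1) lies between the holes (1, T) and (1, T + 2) and hangs on the left column;
   the other tiles below the upper zigzag cells hang on row [T]. *)
- have [x1|x1] := eqVneq x 1.
    apply: (link_trans (left_column (y := T + 1) _ _)); [clear; lia..|].
    apply: link1 => //; last by rewrite ye x1 /adj /=; clear; lia.
    by apply: strip; [clear -cB; lia..|right; left].
  have xA : (x, T) \in A by apply: (gr_row gA); clear -cB; lia.
  apply: (link_trans (old_tile xA _)); first by rewrite xpair_eqE (negbTE x1).
  apply: link1 => //; last by rewrite ye /adj /=; clear; lia.
  by apply: inA => //; clear -x1; lia.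
Qed.

Let old_hole x y : (x, y) \in R -> y <= T - 1.
Proof.
move=> rR; have [_ Rn _] := gr_pits gA.
have /(Rn _ _ rR)/(gr_top gA) /= : adj (x, y) (x, y + 1) by rewrite /adj /=; clear; lia.
by clear; lia.
Qed.

Lemma pits_grow : pits (grow w T A) (grow_holes w T R).
Proof.
have w0 : 2 <= w%:Z by move: w1; clear; lia.
have [RA Rn Re] := gr_pits gA.
have tA : (1, T) \in A by apply: (gr_row gA); clear -w0; lia.
have memH x y : ((x, y) \in grow_holes w T R) = [|| (x == 1) && (y == T),
    [&& 0 < x, x < w%:Z & y == T + 1 + (x %% 2)%Z] | (x, y) \in R].
  by rewrite !in_fsetU in_fset1 mem_zigzag xpair_eqE.
split.
- move=> [x y]; rewrite memH mem_grow => /or3P[/andP[/eqP-> /eqP->]|H|rR].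
  + by rewrite !eqxx andbF /=; clear; lia.
  + by rewrite above; [clear -H; lia|clear -H; lia].
  + by rewrite (negbTE (RA _ rR)) /=; have := old_hole rR; clear; lia.
- move=> [x y] [z u]; rewrite memH => H a.
  have nb : z = x + 1 /\ u = y \/ z = x - 1 /\ u = y \/ z = x /\ u = y + 1 \/
      z = x /\ u = y - 1 by move: a; rewrite /adj /=; clear; lia.
  case/or3P: H => [/andP[/eqP x1 /eqP yT]|H|rR].
  + case: nb => [[-> ->]|[[-> ->]|[[-> ->]|[-> ->]]]]; rewrite x1 yT.
    * by apply: row; clear -w0; lia.
    * by apply: row; clear -w0; lia.
    * by apply: strip; [clear -w0; lia..|right; right; right; clear; lia].
    * by apply: inA; [exact: (gr_diag gA)|clear; lia].
  + have [[y1 xe]|[y2 xo]] : y = T + 1 /\ (x %% 2)%Z = 0 \/ y = T + 2 /\ (x %% 2)%Z = 1.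
      by clear -H; lia.
    * have [zu|zu] : z = x /\ u = T \/ u <> T by clear -nb y1; lia.
        by case: zu => -> ->; apply: row; clear -H xe; lia.
      by apply: strip; [clear -H nb y1 zu; lia..|right; right; right; clear -nb y1 xe zu; lia].
    * apply: strip; [clear -H nb y2; lia..|].
      by right; right; right; clear -nb y2 xo; lia.
  + apply: inA; first exact: Rn rR a.
    move=> [z1 uT]; have yT := old_hole rR; case: nb => [|[|[|]]] [e1 e2].
    * by clear -e2 uT yT; lia.
    * by clear -e2 uT yT; lia.
    * have := RA _ rR; rewrite (_ : (x, y) = (1, T - 1)) ?(gr_diag gA) //.
      by congr pair; clear -e1 e2 z1 uT; lia.
    * by clear -e2 uT yT; lia.
- move=> [x y]; rewrite memH mem_grow => cG cH.
  have cA : (x, y) \notin A.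
    by apply: contraT => /negPn xA; rewrite xA /= in cG; clear -cG cH; lia.
  rewrite (negbTE cA) /= in cG.
  have cR : (x, y) \notin R by apply: contra cH => ->; rewrite !orbT.
  have [yT|yT] := lerP y T.
    case: (Re _ cA cR) => /= fr.
    + by apply: Or41 => z /= zx; rewrite mem_grow (negbTE (fr z zx)) /=; clear -yT; lia.
    + by apply: Or42 => z /= zx; rewrite mem_grow (negbTE (fr z zx)) /=; clear -yT; lia.
    (* A cell at height at most [T] that escapes upwards cannot lie in a column under the strip,
       because row [T] of [A] is full there. *)
    + apply: Or43 => z /= zx; rewrite mem_grow (negbTE (fr z zx)) /=.
      have [x0|x0] := boolP ((0 <= x) && (x <= w%:Z)); last by clear -x0; lia.
      by case/andP: x0 => x0 xw; have := fr T yT; rewrite (gr_row gA).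
    + by apply: Or44 => z /= zx; rewrite mem_grow (negbTE (fr z zx)) /=; clear -yT zx; lia.
  have [x0|[x0|y0]] : x < 0 \/ w%:Z < x \/ T + 3 < y by clear -cG cH yT; lia.
  + by apply: Or42 => z /= zx; rewrite mem_grow above //; clear -x0 zx; lia.
  + by apply: Or41 => z /= zx; rewrite mem_grow above //; clear -x0 zx; lia.
  + by apply: Or43 => z /= zx; rewrite mem_grow above; clear -y0 zx; lia.
Qed.

(** Three rows of [w + 1] cells, less [w - 1] zigzag holes and the tile (1, T). With [w] more holes
    and 3 more rows this is exactly the amount that keeps the side count in balance. *)
Lemma card_grow : #|` grow w T A| = (#|` A| + 2 * w + 3)%N.
Proof.
have tA : (1, T) \in A by apply: (gr_row gA); move: w1; clear; lia.
have dj : (A `\ (1, T)) `&` (band w T `\` zigzag w T) = fset0.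
  apply/fsetP => -[x y]; rewrite in_fset0 in_fsetI in_fsetD1 in_fsetD mem_band /=.
  apply/negP => /andP[/andP[_ /(gr_top gA) /= H]]; clear -H; lia.
have zb : zigzag w T `<=` band w T.
  by apply/fsubsetP => -[x y]; rewrite mem_zigzag mem_band /=; clear; lia.
rewrite /grow cardfsU dj cardfs0 (cardfsDS zb) card_zigzag card_band.
have := cardfsD1 (1, T) A; rewrite tA; move: w1.
by move: #|` A| #|` A `\ (1, T)| => n m; clear; lia.
Qed.

Lemma card_grow_holes : #|` grow_holes w T R| = (#|` R| + w)%N.
Proof.
have tA : (1, T) \in A by apply: (gr_row gA); move: w1; clear; lia.
have [RA _ _] := gr_pits gA.
have tR : (1, T) \notin R by apply: contraL tA; apply: RA.
have dj : zigzag w T `&` R = fset0.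
  apply/fsetP => -[x y]; rewrite in_fset0 in_fsetI mem_zigzag /=.
  by apply/negP => /andP[H /old_hole]; clear -H; lia.
rewrite /grow_holes cardfsU1 cardfsU dj cardfs0 card_zigzag in_fsetU (negbTE tR).
have -> : (1, T) \in zigzag w T = false by rewrite mem_zigzag /=; clear; lia.
by rewrite /=; move: w1; move: #|` R| => n; clear; lia.
Qed.

End Grow.

(** * Configurations with [opt] holes *)

Lemma mem_rectR N M (R : {fset cell}) x y : ((x, y) \in rect N M `\` R) =
  [&& (x, y) \notin R, 0 <= x, x < N%:Z, 0 <= y & y < M%:Z].
Proof. by rewrite in_fsetD mem_rect. Qed.

Lemma config_iso f g N M N' M' R : cell_iso f g ->
  (forall c, (c \in rect N' M') = (g c \in rect N M)) ->
  (forall c, interior N' M' c = interior N M (g c)) ->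
  config N M R -> config N' M' (f @` R).
Proof.
move=> fg fr fi [[Ri Ra] pA]; split; first split.
- by move=> r; rewrite (mem_iso fg) fi; apply: Ri.
- move=> r d; rewrite !(mem_iso fg) => rR dR.
  by have := Ra _ _ rR dR; rewrite -(iso_adj fg) !(isoVK fg).
suff <- : f @` (rect N M `\` R) = rect N' M' `\` f @` R by apply: (polyomino_iso fg).
by apply/fsetP => c; rewrite (mem_iso fg) !in_fsetD (mem_iso fg) fr.
Qed.

Lemma config_swap N M R : config N M R -> config M N (swap @` R).
Proof.
apply: (config_iso iso_swap) => -[x y].
- by rewrite !mem_rect /=; clear; lia.
- by rewrite /interior /=; clear; lia.
Qed.

Lemma config_flipx N M R : config N M R -> config N M (flipx (N%:Z - 1) @` R).
Proof.
apply: (config_iso (iso_flipx _)) => -[x y].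
- by rewrite !mem_rect /=; clear; lia.
- by rewrite /interior /=; clear; lia.
Qed.

Lemma config_flipy N M R : config N M R -> config N M (flipy (M%:Z - 1) @` R).
Proof.
apply: (config_iso (iso_flipy _)) => -[x y].
- by rewrite !mem_rect /=; clear; lia.
- by rewrite /interior /=; clear; lia.
Qed.

Lemma mem_flipx k (R : {fset cell}) x y : ((x, y) \in flipx k @` R) = ((k - x, y) \in R).
Proof. by rewrite (mem_iso (iso_flipx k)). Qed.

Lemma mem_flipy k (R : {fset cell}) x y : ((x, y) \in flipy k @` R) = ((x, k - y) \in R).
Proof. by rewrite (mem_iso (iso_flipy k)). Qed.

Lemma mem_swap (R : {fset cell}) x y : ((x, y) \in swap @` R) = ((y, x) \in R).
Proof. by rewrite (mem_iso iso_swap). Qed.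

Lemma mem_grow_holes w T R x y : ((x, y) \in grow_holes w T R) =
  [|| (x == 1) && (y == T), [&& 0 < x, x < w%:Z & y == T + 1 + (x %% 2)%Z] | (x, y) \in R].
Proof. by rewrite !in_fsetU in_fset1 mem_zigzag xpair_eqE. Qed.

Lemma config_growable N M R : (2 < N)%N -> (1 < M)%N -> config N M R ->
  (1, M%:Z - 2) \notin R -> growable (N - 1) (M%:Z - 1) (rect N M `\` R) R.
Proof.
move=> N2 M1 cR n1; have [_ pA] := cR.
have bA x y : 0 <= x -> x < N%:Z -> 0 <= y -> y < M%:Z ->
    ~~ (interior N M (x, y)) -> (x, y) \in rect N M `\` R.
  move=> x0 xN y0 yM bi; apply: (config_border cR).
  by rewrite /border bi mem_rect /= x0 xN y0 yM.
split=> //.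
- exact: config_pits.
- by move=> [x y]; rewrite mem_rectR /=; clear; lia.
- by move=> x x0 xN; apply: bA; rewrite /interior /=; clear -N2 M1 x0 xN; lia.
- by apply: bA; rewrite /interior /=; clear -N2 M1; lia.
- rewrite mem_rectR (_ : M%:Z - 1 - 1 = M%:Z - 2); last by clear; lia.
  by rewrite n1; clear -N2 M1; lia.
Qed.

(** A corner is free when its diagonal interior neighbour is not a hole. Three rows over the full
    width bring [N - 1] holes, the increment of [opt] in [opt_add3]. *)
Lemma config_grow N M R : (2 < N)%N -> (1 < M)%N -> config N M R ->
  (1, M%:Z - 2) \notin R ->
  config N (M + 3) (grow_holes (N - 1) (M%:Z - 1) R) /\
  #|` grow_holes (N - 1) (M%:Z - 1) R| = (#|` R| + (N - 1))%N.
Proof.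
move=> N2 M1 cR n1; have gA := config_growable N2 M1 cR n1.
have w1 : (1 < N - 1)%N by clear -N2; lia.
split; last exact: card_grow_holes gA.
have [[Ri Ra] pA] := cR; have pG := pits_grow w1 gA.
split; first split.
- move=> [x y]; rewrite mem_grow_holes => /or3P[||/Ri]; rewrite /interior /=;
    clear -N2 M1; lia.
- move=> r d rR dR; apply/negP => /(let: And3 _ Rn _ := pG in Rn _ _ rR).
  by apply/negP; case: pG => RG _ _; apply: RG.
suff -> : rect N (M + 3) `\` grow_holes (N - 1) (M%:Z - 1) R =
    grow (N - 1) (M%:Z - 1) (rect N M `\` R) by apply: (polyomino_grow w1 gA).
apply/fsetP => -[x y]; rewrite mem_grow !mem_rectR mem_grow_holes.
have rI : (x, y) \in R -> y < M%:Z - 1 by move/Ri; rewrite /interior /=; clear; lia.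
by move: rI; case: ((x, y) \in R) => rI; rewrite /= ?orbT ?orbF; clear -rI N2 M1; lia.
Qed.

(** The border ring is full and connected, so only interior tiles have to be linked to it. *)
Lemma config_ring N M R : (1 < N)%N -> (1 < M)%N -> sparse N M R ->
  (forall c, c \in rect N M `\` R -> interior N M c ->
    exists2 d, border N M d & lk (rect N M `\` R) c d) -> config N M R.
Proof.
move=> N1 M1 sR H; split=> //.
have bA c : border N M c -> c \in rect N M `\` R.
  by move=> /andP[c1 c2]; rewrite in_fsetD c1 andbT; apply: contra c2 => /sR.1.
have bl := border_link_full N1 M1 bA.
apply: (@polyomino_root _ (N%:Z - 1, M%:Z - 1)).
  by apply: bA; rewrite /border mem_rect /interior /=; clear -N1 M1; lia.
move=> c cA; have [ci|ci] := boolP (interior N M c).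
  by have [d bd cd] := H c cA ci; apply: link_trans (bl d bd) (link_sym cd).
by apply: bl; rewrite /border ci andbT; move: cA; rewrite in_fsetD => /andP[].
Qed.

Lemma config_near N M R : (1 < N)%N -> (1 < M)%N -> sparse N M R ->
  (forall c, c \in rect N M `\` R -> interior N M c ->
    exists2 d, border N M d & adj c d) -> config N M R.
Proof.
move=> N1 M1 sR H; apply: config_ring => // c cA ci.
have [d bd cd] := H c cA ci; exists d => //; apply: link1 => //.
move: bd => /andP[d1 d2]; rewrite in_fsetD d1 andbT.
by apply: contra d2 => /sR.1.
Qed.

Lemma config_empty2 N : (1 < N)%N -> config N 2 fset0.
Proof.
move=> N1; apply: config_near => // -[x y] _; rewrite /interior /=; clear; lia.
Qed.

(** The zigzag fills the two interior rows. The reflection puts its first hole at (1, 1), which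
    frees the top left corner for growth. *)
Lemma config_strip N : (2 < N)%N -> config N 4 (flipy 3 @` zigzag (N - 1) 0).
Proof.
move=> N2; apply: (@config_flipy N 4); apply: config_near => //; first by clear -N2; lia.
  split=> [[x y]|[x y] [z u]]; rewrite !mem_zigzag /interior /adj /=; clear -N2; lia.
move=> [x y] _; rewrite /interior /= => xi.
have [y1|y2] : y = 1 \/ y = 2 by clear -xi; lia.
  by exists (x, 0); rewrite /border ?mem_rect /interior /adj /=; clear -xi y1; lia.
by exists (x, 3); rewrite /border ?mem_rect /interior /adj /=; clear -xi y2; lia.
Qed.

Lemma card_strip N : (2 < N)%N -> #|` flipy 3 @` zigzag (N - 1) 0| = (N - 2)%N.
Proof. by move=> N2; rewrite (card_iso (iso_flipy 3)) card_zigzag; clear; lia. Qed.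

(* In both states the top left corner is available for [config_grow]; the
   states alternate when growing, up to a reflection of the box. *)
Definition diag_state (N M h : nat) : Prop := exists R,
  [/\ config N M R, #|` R| = h & [/\ (1, M%:Z - 2) \notin R, (N%:Z - 2, 1) \notin R & (1, 1) \in R]].
Definition side_state (N M h : nat) : Prop := exists R,
  [/\ config N M R, #|` R| = h & [/\ (1, M%:Z - 2) \notin R, (1, 1) \notin R & (N%:Z - 2, 1) \in R]].

(** The new zigzag takes the top left corner; for even [N] its last hole, in the even column
    [N - 2], is in the lower position, so the top right corner is free. The reflection brings that
    corner to the left, ready for the next step. *)
Lemma flip_grow N M R : (2 < N)%N -> (1 < M)%N -> ~~ odd N -> config N M R ->
  (1, M%:Z - 2) \notin R ->
  let R' := flipx (N%:Z - 1) @` grow_holes (N - 1) (M%:Z - 1) R in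
  [/\ config N (M + 3) R', #|` R'| = (#|` R| + (N - 1))%N,
      (1, (M + 3)%N%:Z - 2) \notin R' &
      forall x, (2 < M)%N -> ((x, 1) \in R') = ((N%:Z - 1 - x, 1) \in R)].
Proof.
move=> N2 M1 Ne cR n1 R'; have [cG cG'] := config_grow N2 M1 cR n1.
have [[Ri _] _] := cR; split.
- exact: config_flipx.
- by rewrite (card_iso (iso_flipx _)).
- rewrite mem_flipx mem_grow_holes !negb_or; apply/and3P; split.
  + by clear; lia.
  + by clear -Ne N2; lia.
  + by apply/negP => /Ri; rewrite /interior /=; clear; lia.
- move=> x M2; rewrite mem_flipx mem_grow_holes.
  by case: (_ \in R); rewrite ?orbT // orbF; clear -M2; lia.
Qed.

Lemma diag_side N M h : ~~ odd N -> (2 < N)%N -> (2 < M)%N ->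
  diag_state N M h -> side_state N (M + 3) (h + (N - 1)).
Proof.
move=> Ne N2 M2 [R [cR <- [n1 n2 n3]]]; have M1 : (1 < M)%N by clear -M2; lia.
have [c1 c2 c3 c4] := flip_grow N2 M1 Ne cR n1; eexists; split; [exact: c1|exact: c2|].
split=> //; rewrite c4 //; last by rewrite (_ : N%:Z - 1 - _ = 1) //; clear; lia.
by rewrite (_ : N%:Z - 1 - 1 = N%:Z - 2) //; clear; lia.
Qed.

Lemma side_diag N M h : ~~ odd N -> (2 < N)%N -> (2 < M)%N ->
  side_state N M h -> diag_state N (M + 3) (h + (N - 1)).
Proof.
move=> Ne N2 M2 [R [cR <- [n1 n2 n3]]]; have M1 : (1 < M)%N by clear -M2; lia.
have [c1 c2 c3 c4] := flip_grow N2 M1 Ne cR n1; eexists; split; [exact: c1|exact: c2|].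
split=> //; rewrite c4 //; first by rewrite (_ : N%:Z - 1 - _ = 1) //; clear; lia.
by rewrite (_ : N%:Z - 1 - 1 = N%:Z - 2) //; clear; lia.
Qed.

Lemma diag_swap N M h : diag_state N M h -> diag_state M N h.
Proof.
move=> [R [cR cc [n1 n2 n3]]]; exists (swap @` R); split.
- exact: config_swap.
- by rewrite (card_iso iso_swap).
- by rewrite !mem_swap.
Qed.

Lemma diag_strip N : ~~ odd N -> (2 < N)%N -> diag_state N 4 (N - 2).
Proof.
move=> Ne N2; exists (flipy 3 @` zigzag (N - 1) 0); split.
- exact: config_strip.
- exact: card_strip.
- by rewrite !mem_flipy !mem_zigzag /=; clear -Ne N2; split; lia.
Qed.

Lemma sparse_seq N M (l : seq cell) : all (interior N M) l ->
  all (fun r => all (fun d => ~~ adj r d) l) l -> sparse N M (seq_fset tt l).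
Proof.
move=> /allP li /allP la; split=> [r|r d]; rewrite !seq_fsetE; first exact: li.
by move=> /la/allP; apply.
Qed.

Lemma side_6_3 : side_state 6 3 2.
Proof.
pose l : seq cell := [:: (2, 1); (4, 1)]; exists (seq_fset tt l).
split; [|by rewrite size_seq_fset undup_id|by rewrite !seq_fsetE].
apply: config_near => //; first exact: sparse_seq.
move=> [x y] _ xi; exists (x, 0).
  by move: xi; rewrite /border mem_rect /interior /=; clear; lia.
by move: xi; rewrite /interior /adj /=; clear; lia.
Qed.

Lemma side_6_5 : side_state 6 5 5.
Proof.
have n1 : (1, 2%:Z - 2) \notin (fset0 : {fset cell}) by rewrite in_fset0.
have [c1 c2 c3 _] := @flip_grow 6 2 fset0 isT isT isT (@config_empty2 6 isT) n1.
eexists; split; [exact: c1|by rewrite c2 cardfs0|split=> //].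
  by rewrite mem_flipx mem_grow_holes in_fset0.
by rewrite mem_flipx mem_grow_holes.
Qed.

(** Growing the empty 8 x 2 box gives only 7 holes, one less than [opt 8 5], hence an explicit
    pattern. Its tiles (2, 2), (3, 2), (4, 2) are reached through column 3; all others in the
    interior touch the border. *)
Lemma side_8_5 : side_state 8 5 8.
Proof.
pose l : seq cell := [:: (2, 1); (4, 1); (6, 1); (2, 3); (4, 3); (6, 3); (1, 2); (5, 2)].
have sl : sparse 8 5 (seq_fset tt l) by apply: sparse_seq.
exists (seq_fset tt l); split; [|by rewrite size_seq_fset undup_id|by rewrite !seq_fsetE].
apply: config_ring => // -[x y] xA xi.
have inA z u : [&& (z, u) \notin l, 0 <= z, z < 8, 0 <= u & u < 5] ->
    (z, u) \in rect 8 5 `\` seq_fset tt l by rewrite mem_rectR seq_fsetE.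
have := xA; rewrite mem_rectR seq_fsetE !inE !xpair_eqE => xl.
move: xi; rewrite /interior /= => xi.
have [x0|[y0|[y0|[x6|y2]]]] : x = 0 \/ y = 1 \/ y = 3 \/ x = 6 /\ y = 2 \/
    y = 2 /\ (x = 2 \/ x = 3 \/ x = 4) by clear -xl xi; lia.
- by clear -x0 xi; lia.
- have bA : border 8 5 (x, 0) by rewrite /border mem_rect /interior /=; clear -xi; lia.
  exists (x, 0) => //; apply: link1 => //; last by rewrite y0 /adj /=; clear; lia.
  by apply: inA; rewrite !inE !xpair_eqE; clear -xi; lia.
- have bA : border 8 5 (x, 4) by rewrite /border mem_rect /interior /=; clear -xi; lia.
  exists (x, 4) => //; apply: link1 => //; last by rewrite y0 /adj /=; clear; lia.
  by apply: inA; rewrite !inE !xpair_eqE; clear -xi; lia.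
- have bA : border 8 5 (7, 2) by rewrite /border mem_rect.
  case: x6 => x6 y2; exists (7, 2) => //; apply: link1 => //; first exact: inA.
  by rewrite x6 y2.
have bA : border 8 5 (3, 0) by rewrite /border mem_rect.
case: y2 => -> x24; exists (3, 0) => //.
have to3 : lk (rect 8 5 `\` seq_fset tt l) (x, 2) (3, 2).
  by case: x24 => [->|[->|->]]; [apply: link1|apply: link_refl|apply: link1] => //; apply: inA.
apply: (link_trans to3); apply/link_sym/link_vseg => // u u0 u2; apply: inA.
by rewrite !inE !xpair_eqE; clear -u0 u2; lia.
Qed.

(** The largest h with 3h + 3 <= (N-1)(M-1) once this product is at least 3; truncated subtraction
    gives 0 for smaller boxes. *)
Definition opt (N M : nat) : nat := ((N - 1) * (M - 1) %/ 3 - 1)%N.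

Lemma optC N M : opt N M = opt M N.
Proof. by rewrite /opt mulnC. Qed.

Lemma opt_add3 N M : (3 < N)%N -> (1 < M)%N -> opt N (M + 3) = (opt N M + (N - 1))%N.
Proof.
move=> N3 M1; rewrite /opt (_ : (N - 1) * (M + 3 - 1) = (N - 1) * 3 + (N - 1) * (M - 1))%N.
  rewrite divnMDl //; have : (0 < (N - 1) * (M - 1) %/ 3)%N.
    by rewrite divn_gt0 //; nia.
  by move: (_ %/ 3)%N => q; lia.
by nia.
Qed.

(** Two growth steps restore the state, so either side can be extended by 6, exchanging the sides by
    [diag_swap]. This leaves sides 4, 6, 8: height 4 is the strip, and the other boxes come from one
    growth step on the seeds 6 x 3, 6 x 5, 8 x 5. *)
Lemma diag_opt N M : ~~ odd N -> ~~ odd M -> (3 < N)%N -> (3 < M)%N ->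
  diag_state N M (opt N M).
Proof.
have up N' M' : ~~ odd N' -> (3 < N')%N -> (3 < M')%N ->
    diag_state N' M' (opt N' M') -> diag_state N' (M' + 6) (opt N' (M' + 6)).
  move=> e n m H; rewrite (_ : M' + 6 = M' + 3 + 3)%N; last by lia.
  rewrite !opt_add3; [|lia..].
  by apply: side_diag; [| |lia|apply: diag_side]; rewrite //; lia.
have side3 N' M' h : ~~ odd N' -> (3 < N')%N -> (2 < M')%N -> h = opt N' M' ->
    side_state N' M' h -> diag_state N' (M' + 3) (opt N' (M' + 3)).
  move=> e n m -> H; rewrite opt_add3; [|lia..].
  by apply: side_diag => //; lia.
have strip N' : ~~ odd N' -> (3 < N')%N -> diag_state N' 4 (opt N' 4).
  move=> e n; rewrite (_ : opt N' 4 = N' - 2)%N; last by rewrite /opt mulnK //; lia.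
  by apply: diag_strip; rewrite // ltnW.
have d66 : diag_state 6 6 (opt 6 6) by apply: (@side3 6 3 2) => //; exact: side_6_3.
have d68 : diag_state 6 8 (opt 6 8) by apply: (@side3 6 5 5) => //; exact: side_6_5.
have d88 : diag_state 8 8 (opt 8 8) by apply: (@side3 8 5 8) => //; exact: side_8_5.
elim/ltn_ind: M N => M IHM N; elim/ltn_ind: N => N IHN Ne Me N3 M3.
have [N9|N9] := ltnP 9 N.
  rewrite optC; apply: diag_swap; rewrite (_ : N = N - 6 + 6)%N; last by lia.
  by apply: up => //; first lia; rewrite optC; apply/diag_swap/IHN => //; lia.
have [M9|M9] := ltnP 9 M.
  rewrite (_ : M = M - 6 + 6)%N; last by lia.
  by apply: up => //; first lia; apply: IHM => //; lia.
have hN : [|| N == 4, N == 6 | N == 8]%N by lia.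
have hM : [|| M == 4, M == 6 | M == 8]%N by lia.
case/or3P: hN => /eqP ->; case/or3P: hM => /eqP -> //; try exact: strip.
- by rewrite optC; apply/diag_swap/strip.
- by rewrite optC; apply/diag_swap/strip.
- by rewrite optC; apply/diag_swap.
Qed.

Lemma side_opt N M : ~~ odd N -> odd M -> (3 < N)%N -> (6 < M)%N ->
  side_state N M (opt N M).
Proof.
move=> Ne Mo N3 M6; rewrite (_ : M = M - 3 + 3)%N; last by lia.
rewrite opt_add3; [|lia..]; apply: diag_side => //; [lia|lia|].
by apply: diag_opt => //; lia.
Qed.

Definition has_config (N M h : nat) : Prop := exists2 R, config N M R & #|` R| = h.

Lemma has_config_swap N M h : has_config N M h -> has_config M N h.
Proof.
move=> [R cR cc]; exists (swap @` R); first exact: config_swap.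
by rewrite (card_iso iso_swap).
Qed.

Lemma has_config_opt N b : (b <= 1)%N -> (0 < opt N (N + b))%N ->
  has_config N (N + b) (opt N (N + b)).
Proof.
move=> b1 o0; have N3 : (2 < N)%N.
  by move: o0; case: N => [|[|[|N]]] //; case: b b1 => [|[|]].
have diag N' M' h : diag_state N' M' h -> has_config N' M' h.
  by case=> R [cR cc _]; exists R.
have side N' M' h : side_state N' M' h -> has_config N' M' h.
  by case=> R [cR cc _]; exists R.
have strip N' : (3 < N')%N -> has_config N' 4 (opt N' 4).
  move=> n; rewrite (_ : opt N' 4 = N' - 2)%N; last by rewrite /opt mulnK //; lia.
  exists (flipy 3 @` zigzag (N' - 1) 0); first by apply: config_strip; lia.
  by apply: card_strip; lia.
have n2 : (1, 2%:Z - 2) \notin (fset0 : {fset cell}) by rewrite in_fset0.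
have [b0|b0] : b = 0%N \/ b = 1%N by lia.
  subst b; rewrite addn0 in o0 *.
  have [No|Ne] := boolP (odd N); last by apply/diag/diag_opt => //; lia.
  have [N5|N5] := eqVneq N 5%N.
    have [c1 c2] := @config_grow 5 2 fset0 isT isT (@config_empty2 5 isT) n2.
    by subst N; eexists; [exact: c1|rewrite c2 cardfs0].
  have N6 : (6 < N)%N by move: o0; case: N N5 No N3 => [|[|[|[|[|[|[|]]]]]]].
  (* An odd square is grown from a box of even width [N - 3] and odd height [N], turned so that its
     second free corner (1, 1) becomes the top left one. *)
  have [R [cR cc [n1 n3 _]]] : side_state (N - 3) N (opt (N - 3) N).
    by apply: side_opt => //; lia.
  have cS := @config_flipy N (N - 3) _ (config_swap cR).
  have /(config_grow _ _ cS)[||c1 c2] :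
      (1, (N - 3)%N%:Z - 2) \notin flipy ((N - 3)%N%:Z - 1) @` (swap @` R).
  - rewrite mem_flipy mem_swap (_ : (N - 3)%N%:Z - 1 - ((N - 3)%N%:Z - 2) = 1) //.
    by lia.
  - by lia.
  - by lia.
  rewrite {1 2}(_ : N = N - 3 + 3)%N; last by lia.
  rewrite (_ : N - 3 + 3 = N)%N in c1 *; last by lia.
  eexists; [exact: c1|rewrite c2 (card_iso (iso_flipy _)) (card_iso iso_swap) cc].
  rewrite (_ : opt N N = opt N (N - 3 + 3)); last by congr opt; lia.
  by rewrite opt_add3 1?optC //; lia.
subst b; have [N3'|N3'] := eqVneq N 3%N.
  by subst N; exists (flipy 3 @` zigzag 2 0);
    [apply: (@config_strip 3)|rewrite (@card_strip 3)].
have [N4|N4] := eqVneq N 4%N.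
  by subst N; apply: has_config_swap; rewrite optC; apply: strip.
have [N5|N5] := eqVneq N 5%N.
  by subst N; apply: has_config_swap; rewrite optC; apply/side/side_6_5.
have [No|Ne] := boolP (odd N).
  by apply: has_config_swap; rewrite optC; apply/side/side_opt; lia.
by apply/side/side_opt => //; lia.
Qed.

(** * Tight polyominoes *)

(* A polyomino with [h] holes attaining [tile_bound] when the numbers of its
   rows and columns add up to [s]. *)
Definition tight (s h : nat) : Prop := exists A,
  [/\ polyomino A, num_holes A h & (#|` A| + 1 = 2 * h + s)%N].

Lemma polyomino_remove_near A t d : polyomino A -> t \in A -> d \in A -> d != t ->
  (forall n, n \in A -> adj t n -> n = d \/ adj d n) -> polyomino (A `\ t).
Proof.
move=> pA tA dA dt nb; apply: (polyomino_remove pA tA dA dt) => n nA tn.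
have dB : d \in A `\ t by rewrite in_fsetD1 dt.
have nB : n \in A `\ t.
  rewrite in_fsetD1 nA andbT; apply: contraTneq tn => ->.
  by rewrite /adj !subrr.
by case: (nb n nA tn) => [->|dn]; [apply: link_refl|apply: link1].
Qed.

Lemma pits_remove A R t : pits A R -> (forall r, r \in R -> ~~ adj r t) ->
  escapes (A `\ t) t -> pits (A `\ t) R.
Proof.
move=> [RA Rn Re] Rt te; split.
- by move=> r /RA; apply: contra; rewrite in_fsetD1 => /andP[].
- move=> r d rR rd; rewrite in_fsetD1 (Rn _ _ rR rd) andbT.
  by apply: contraTneq rd => ->; apply: Rt.
- move=> c; rewrite in_fsetD1 negb_and negbK => /orP[/eqP->//|cA] cR.
  have sub z : z \notin A -> z \notin A `\ t by apply: contra; rewrite in_fsetD1 => /andP[].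
  by case: (Re _ cA cR) => fr; [apply: Or41|apply: Or42|apply: Or43|apply: Or44] => z /fr/sub.
Qed.

Lemma cut_corner N M R k : (1 < N)%N -> (1 < M)%N -> config N M R ->
  k \in [fset (0, 0); (0, M%:Z - 1); (N%:Z - 1, 0)] ->
  polyomino (rect N M `\` R `\ k).
Proof.
move=> N1 M1 cR; rewrite !inE -orbA => /or3P[] /eqP ->.
- exact: cutcorner.
- have := polyomino_iso (iso_flipy (M%:Z - 1)) (cutcorner N1 M1 (config_flipy cR)).
  congr polyomino; apply/fsetP => -[x y]; rewrite mem_flipy !in_fsetD1 !mem_rectR mem_flipy.
  rewrite !xpair_eqE (_ : M%:Z - 1 - (M%:Z - 1 - y) = y); last by clear; lia.
  by clear; case: (_ \in R) => //=; lia.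
- have := polyomino_iso (iso_flipx (N%:Z - 1)) (cutcorner N1 M1 (config_flipx cR)).
  congr polyomino; apply/fsetP => -[x y]; rewrite mem_flipx !in_fsetD1 !mem_rectR mem_flipx.
  rewrite !xpair_eqE (_ : N%:Z - 1 - (N%:Z - 1 - x) = x); last by clear; lia.
  by clear; case: (_ \in R) => //=; lia.
Qed.

Definition corners3 (N M : nat) : {fset cell} :=
  [fset (0, 0); (0, M%:Z - 1); (N%:Z - 1, 0)].

(** Both neighbours of a corner are adjacent to the interior cell diagonal to it; if that cell is a
    tile, the corner can be removed without disconnecting anything. *)
Lemma cut_diagonal N M R (K : {fset cell}) (x y x' y' : int) :
  (2 < N)%N -> (2 < M)%N -> config N M R ->
  polyomino (rect N M `\` R `\` K) -> (forall k, k \in K -> corner N M k) ->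
  (x, y) \notin K ->
  (x = 0 /\ x' = 1 \/ x = N%:Z - 1 /\ x' = N%:Z - 2) ->
  (y = 0 /\ y' = 1 \/ y = M%:Z - 1 /\ y' = M%:Z - 2) ->
  (x', y') \notin R -> polyomino (rect N M `\` R `\` ((x, y) |` K)).
Proof.
move=> N2 M2 cR pA Kc xK hx hy n1.
rewrite (_ : rect N M `\` R `\` ((x, y) |` K) = rect N M `\` R `\` K `\ (x, y)); last first.
  apply/fsetP => c; rewrite in_fsetD1 !in_fsetD in_fset1U negb_or.
  by case: (c == _) (c \in K) => [] [].
apply: (polyomino_remove_near (d := (x', y')) pA).
- rewrite in_fsetD xK; apply: (config_border cR).
  by rewrite /border mem_rect /interior /=; clear -N2 M2 hx hy; lia.
- rewrite in_fsetD mem_rectR n1; apply/andP; split.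
    by apply/negP => /Kc; rewrite /corner /=; clear -N2 M2 hx hy; lia.
  by clear -N2 M2 hx hy; lia.
- by rewrite xpair_eqE; clear -hx hy; lia.
move=> [z u]; rewrite in_fsetD mem_rectR /adj /= => /andP[_ /andP[_ zu]] a; right.
by clear -zu a hx hy; lia.
Qed.

Lemma corners3_corner N M k : k \in corners3 N M -> corner N M k.
Proof.
by rewrite !inE -orbA => /or3P[] /eqP ->; rewrite /corner /=; clear; lia.
Qed.

Lemma card_corners3 N M : (1 < N)%N -> (1 < M)%N -> #|` corners3 N M| = 3%N.
Proof.
move=> N1 M1; rewrite /corners3 fsetUC cardfsU1 cardfs2 !inE !xpair_eqE.
by clear -N1 M1; lia.
Qed.

(** One corner can always be cut thanks to the border ring; each further one needs its diagonal cell
    free. Hence two free corners among the three suffice, and they are cut after the remaining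
    one. *)
Lemma cut_corners3 N M R : (2 < N)%N -> (2 < M)%N -> config N M R ->
  [\/ (1, M%:Z - 2) \notin R /\ (N%:Z - 2, 1) \notin R,
      (1, M%:Z - 2) \notin R /\ (1, 1) \notin R |
      (1, 1) \notin R /\ (N%:Z - 2, 1) \notin R] ->
  polyomino (rect N M `\` R `\` corners3 N M).
Proof.
move=> N2 M2 cR H; have N1 := ltnW N2; have M1 := ltnW M2.
have cut k : k \in corners3 N M -> polyomino (rect N M `\` R `\` [fset k]).
  exact: cut_corner.
have k1 : (0, 0) \in corners3 N M by rewrite !inE eqxx.
have k2 : (0, M%:Z - 1) \in corners3 N M by rewrite !inE eqxx ?orbT.
have k3 : (N%:Z - 1, 0) \in corners3 N M by rewrite !inE eqxx ?orbT.
have c1 k : k \in corners3 N M -> forall z, z \in [fset k] -> corner N M z.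
  by move=> kK z; rewrite inE => /eqP ->; apply: corners3_corner.
have c2 k k' : k \in corners3 N M -> k' \in corners3 N M ->
    forall z, z \in k' |` [fset k] -> corner N M z.
  by move=> kK kK' z; rewrite !inE => /orP[] /eqP ->; apply: corners3_corner.
case: H => -[n1 n2].
- rewrite (_ : corners3 N M = (0, M%:Z - 1) |` ((N%:Z - 1, 0) |` [fset (0, 0)])).
    apply: (cut_diagonal (x' := 1) (y' := M%:Z - 2) N2 M2 cR) => //.
    + apply: (cut_diagonal (x' := N%:Z - 2) (y' := 1) N2 M2 cR) => //.
      * exact: cut.
      * exact: c1.
      * by rewrite !inE !xpair_eqE; clear -N2 M2; lia.
      * by right.
      * by left.
    + exact: c2.
    + by rewrite !inE !xpair_eqE; clear -N2 M2; lia.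
    + by left.
    + by right.
  by apply/fsetP => c; rewrite !inE; case: (c == _) (c == _) (c == _) => [] [] [].
- rewrite (_ : corners3 N M = (0, M%:Z - 1) |` ((0, 0) |` [fset (N%:Z - 1, 0)])).
    apply: (cut_diagonal (x' := 1) (y' := M%:Z - 2) N2 M2 cR) => //.
    + apply: (cut_diagonal (x' := 1) (y' := 1) N2 M2 cR) => //.
      * exact: cut.
      * exact: c1.
      * by rewrite !inE !xpair_eqE; clear -N2 M2; lia.
      * by left.
      * by left.
    + exact: c2.
    + by rewrite !inE !xpair_eqE; clear -N2 M2; lia.
    + by left.
    + by right.
  by apply/fsetP => c; rewrite !inE; case: (c == _) (c == _) (c == _) => [] [] [].
- rewrite (_ : corners3 N M = (0, 0) |` ((N%:Z - 1, 0) |` [fset (0, M%:Z - 1)])).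
    apply: (cut_diagonal (x' := 1) (y' := 1) N2 M2 cR) => //.
    + apply: (cut_diagonal (x' := N%:Z - 2) (y' := 1) N2 M2 cR) => //.
      * exact: cut.
      * exact: c1.
      * by rewrite !inE !xpair_eqE; clear -N2 M2; lia.
      * by right.
      * by left.
    + exact: c2.
    + by rewrite !inE !xpair_eqE; clear -N2 M2; lia.
    + by left.
    + by left.
  by apply/fsetP => c; rewrite !inE; case: (c == _) (c == _) (c == _) => [] [] [].
Qed.

Definition cut_state (N M h : nat) (R : {fset cell}) : Prop :=
  [/\ sparse N M R, polyomino (rect N M `\` R `\` corners3 N M) & #|` R| = h].

(** The cut box has NM - h - 3 tiles, so the hypothesis on [h] is the tightness equation for
    semiperimeter N + M. *)
Lemma cut_tight N M h R : (1 < N)%N -> (1 < M)%N ->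
  (3 * h + 3 = (N - 1) * (M - 1))%N -> cut_state N M h R -> tight (N + M) h.
Proof.
move=> N1 M1 D [sR pA cc]; eexists; split; [exact: pA| |].
  by rewrite -cc; apply/pits_num/sparse_pits => // k; apply: corners3_corner.
have Kb k : k \in corners3 N M -> border N M k.
  rewrite !inE -orbA /border mem_rect => /or3P[] /eqP ->; rewrite /interior /=;
  by clear -N1 M1; lia.
have := card_board sR Kb; rewrite card_corners3 // cc.
move: #|` _| => n H; clear -N1 M1 D H; nia.
Qed.

Lemma cut_of_config N M R : (2 < N)%N -> (2 < M)%N -> config N M R ->
  [\/ (1, M%:Z - 2) \notin R /\ (N%:Z - 2, 1) \notin R,
      (1, M%:Z - 2) \notin R /\ (1, 1) \notin R |
      (1, 1) \notin R /\ (N%:Z - 2, 1) \notin R] -> cut_state N M #|` R| R.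
Proof. by move=> N2 M2 cR H; split=> //; [case: cR|apply: cut_corners3]. Qed.

Lemma cut_diag N M h : (2 < N)%N -> (2 < M)%N -> diag_state N M h ->
  exists R, cut_state N M h R.
Proof.
move=> N2 M2 [R [cR <- [n1 n2 _]]]; exists R.
by apply: cut_of_config => //; constructor 1.
Qed.

Lemma cut_side N M h : (2 < N)%N -> (2 < M)%N -> side_state N M h ->
  exists R, cut_state N M h R.
Proof.
move=> N2 M2 [R [cR <- [n1 n2 _]]]; exists R.
by apply: cut_of_config => //; constructor 2.
Qed.

(** Unreflected, the zigzag has its odd columns in the upper position; for odd [N] both ends are
    odd, and the two bottom corners are free. *)
Lemma cut_strip N : (2 < N)%N -> odd N -> exists R, cut_state N 4 (N - 2) R.
Proof.
move=> N2 No; exists (zigzag (N - 1) 0).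
have cR : config N 4 (zigzag (N - 1) 0).
  have := @config_flipy N 4 _ (config_strip N2); congr config.
  by apply/fsetP => -[x y]; rewrite !mem_flipy (_ : 3 - _ = y) //; clear; lia.
rewrite (_ : N - 2 = #|` zigzag (N - 1) 0|)%N; last by rewrite card_zigzag; clear; lia.
by apply: cut_of_config => //; constructor 3; rewrite !mem_zigzag /=; clear -No N2; lia.
Qed.

(* When the corner [(0, 0)] is missing and [(1, 1)] is a hole, the tiles [(1, 0)]
   and [(0, 1)] are leaves: removing both opens that hole. *)
Lemma open_corner A R : polyomino A -> pits A R ->
  (forall c : cell, c \in A -> (0 <= c.1) && (0 <= c.2)) ->
  (0, 0) \notin A -> (1, 1) \in R -> (2, 0) \in A -> (0, 2) \in A ->
  let B := A `\ (1, 0) `\ (0, 1) in let S := R `\ (1, 1) in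
  [/\ polyomino B, pits B S, (#|` B| + 2 = #|` A|)%N & (#|` S| + 1 = #|` R|)%N].
Proof.
move=> pA pR A0 c0 r1 t20 t02 B S; have [RA Rn Re] := pR.
have t10 : (1, 0) \in A by apply: Rn r1 _.
have t01 : (0, 1) \in A by apply: Rn r1 _.
have Rpos x y : (x, y) \in R -> 0 < x /\ 0 < y.
  move=> rR; have /A0/andP[/= h1 _] : (x - 1, y) \in A.
    by apply: Rn rR _; rewrite /adj /=; clear; lia.
  have /A0/andP[/= _ h2] : (x, y - 1) \in A.
    by apply: Rn rR _; rewrite /adj /=; clear; lia.
  by clear -h1 h2; lia.
have pA1 : polyomino (A `\ (1, 0)).
  apply: (polyomino_remove_near (d := (2, 0)) pA) => // -[x y] xA.
  rewrite /adj /= => a; left; have /= := A0 _ xA => x0.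
  have [[-> ->]|[[x1 y1]|[x1 y1]]] : x = 2 /\ y = 0 \/ x = 0 /\ y = 0 \/ x = 1 /\ y = 1.
    by clear -a x0; lia.
  - by [].
  - by rewrite x1 y1 (negbTE c0) in xA.
  - by rewrite x1 y1 (negbTE (RA _ r1)) in xA.
have pB : polyomino B.
  apply: (polyomino_remove_near (d := (0, 2)) pA1); rewrite ?in_fsetD1 ?t02 ?t01 //.
  move=> [x y]; rewrite in_fsetD1 => /andP[_ xA].
  rewrite /adj /= => a; left; have /= := A0 _ xA => x0.
  have [[-> ->]|[[x1 y1]|[x1 y1]]] : x = 0 /\ y = 2 \/ x = 0 /\ y = 0 \/ x = 1 /\ y = 1.
    by clear -a x0; lia.
  - by [].
  - by rewrite x1 y1 (negbTE c0) in xA.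
  - by rewrite x1 y1 (negbTE (RA _ r1)) in xA.
have subB c : c \notin A -> c \notin B.
  by apply: contra; rewrite !in_fsetD1 => /and3P[].
split=> //.
- split.
  + by move=> r; rewrite in_fsetD1 => /andP[_ /RA/subB].
  + move=> [x y] [z u]; rewrite in_fsetD1 xpair_eqE => /andP[n1 rR] a.
    rewrite !in_fsetD1 (Rn _ _ rR a) !xpair_eqE; have [x0 y0] := Rpos _ _ rR.
    by move: a; rewrite /adj /=; clear -n1 x0 y0; lia.
  + move=> [x y] cB cR.
    have bot z : z <= 1 -> (1, z) \notin B.
      move=> z1; have [->|z2] := eqVneq z 1; first exact/subB/RA.
      have [->|z3] := eqVneq z 0; first by rewrite !in_fsetD1 eqxx ?andbF.
      by apply/subB/negP => /A0 /=; clear -z1 z2 z3; lia.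
    have lft z : z <= 0 -> (z, 1) \notin B.
      move=> z1; have [->|z2] := eqVneq z 0; first by rewrite !in_fsetD1 eqxx.
      by apply/subB/negP => /A0 /=; clear -z1 z2; lia.
    have [cA|cA] := boolP ((x, y) \in A).
      have : ((x, y) == (1, 0)) || ((x, y) == (0, 1)).
        by move: cB; rewrite !in_fsetD1 cA andbT negb_and !negbK orbC.
      case/orP => /eqP [-> ->].
        by apply: Or44 => z /= z0; apply: bot; clear -z0; lia.
      by apply: Or42 => z /= z0; apply: lft.
    have [e|n1] := eqVneq (x, y) (1, 1).
      by case: e => -> ->; apply: Or44 => z /= z0; apply: bot.
    have cR' : (x, y) \notin R by move: cR; rewrite in_fsetD1 n1.
    by case: (Re _ cA cR') => fr; [apply: Or41|apply: Or42|apply: Or43|apply: Or44]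
      => z /fr/subB.
- have e1 := cardfsD1 (1, 0) A; have e2 := cardfsD1 (0, 1) (A `\ (1, 0)).
  rewrite t10 in e1; rewrite in_fsetD1 t01 /= in e2.
  by move: e1 e2; rewrite -/B; move: #|` B| #|` A| #|` A `\ _| => a b c; clear; lia.
- by rewrite (cardfsD1 (1, 1) R) r1 addnC.
Qed.

(** * Strips over a part of the width *)

Definition ready (a h n : nat) : Prop := exists T A R,
  [/\ growable a T A R, #|` R| = h & #|` A| = n].

Lemma mem_grow_top w T A R x y : growable w T A R -> T < y ->
  ((x, y) \in grow w T A) =
  [&& 0 <= x, x <= w%:Z, y <= T + 3 & ~~ [&& 0 < x, x < w%:Z & y == T + 1 + (x %% 2)%Z]].
Proof.
move=> gA yT; rewrite mem_grow.
have -> : (x, y) \in A = false by apply/negP => /(gr_top gA) /=; clear -yT; lia.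
by rewrite /=; clear -yT; lia.
Qed.

(** For odd [a] the zigzag ends in the lower position in column [a - 1], so after reflection the
    cell required by [gr_diag] is a tile. *)
Lemma ready_grow a h n : odd a -> (1 < a)%N -> ready a h n ->
  ready a (h + a) (n + 2 * a + 3).
Proof.
move=> ao a1 [T [A [R [gA <- <-]]]]; have i := iso_flipx a%:Z.
exists (T + 3), (flipx a%:Z @` grow a T A), (flipx a%:Z @` grow_holes a T R).
split; last 2 first.
- by rewrite (card_iso i) (card_grow_holes a1 gA).
- by rewrite (card_iso i) (card_grow a1 gA).
have mg x y := @mem_grow_top a T A R x y gA.
split.
- exact: (polyomino_iso i (polyomino_grow a1 gA)).
- exact: (pits_iso i (pits_grow a1 gA)).
- move=> [x y]; rewrite mem_flipx mem_grow => /orP[/andP[/(gr_top gA) /= H _]|H] /=.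
    by clear -H; lia.
  by clear -H; lia.
- by move=> x x0 xa; rewrite mem_flipx mg; clear -x0 xa; lia.
- by rewrite mem_flipx mg; clear; lia.
- by rewrite mem_flipx mg; clear -ao a1; lia.
Qed.

Lemma growable_sub w a T A R : (w <= a)%N -> growable a T A R -> growable w T A R.
Proof.
move=> wa [pA pR tA rA lA dA]; split=> // x x0 xw; apply: rA => //.
by clear -wa xw; lia.
Qed.

(** A strip narrower than the box adds the same three rows but only [w] holes. For odd [w] its top
    right corner has a tile as diagonal neighbour and is cut as well, hence one tile less than in
    [card_grow]. *)
Lemma ready_strip a h n w : ready a h n -> odd w -> (1 < w <= a)%N -> exists A,
  [/\ polyomino A, num_holes A (h + w) & #|` A| = (n + 2 * w + 2)%N].
Proof.
move=> [T [A [R [gA' <- <-]]]] wo /andP[w1 wa]; have gA := growable_sub wa gA'.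
have mg x y := @mem_grow_top w T A R x y gA.
have pG := pits_grow w1 gA; have [RG RN _] := pG.
have tG : (w%:Z, T + 3) \in grow w T A by rewrite mg; clear; lia.
exists (grow w T A `\ (w%:Z, T + 3)); split.
- apply: (polyomino_remove_near (d := (w%:Z - 1, T + 2)) (polyomino_grow w1 gA)) => //.
  + by rewrite mg; clear -wo w1; lia.
  + by rewrite xpair_eqE; clear; lia.
  + move=> [x y] xG e; right; move: e; rewrite /adj /= => e.
    move: xG; rewrite mg; last by clear -e; lia.
    by clear -e; lia.
- rewrite -(card_grow_holes w1 gA); apply/pits_num/pits_remove => //.
  + move=> [x y] rR; apply/negP => e; have := RG _ rR; apply/negP; rewrite negbK.
    have yT : T < y by move: e; rewrite /adj /=; clear; lia.
    have : ~~ [&& x == w%:Z & y == T + 4] && ~~ [&& x == w%:Z + 1 & y == T + 3].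
      rewrite mem_grow_holes in rR.
      have xR : (x, y) \in R = false.
        apply/negP => xR; have [_ Rn _] := gr_pits gA.
        have /(Rn _ _ xR)/(gr_top gA) /= : adj (x, y) (x - 1, y) by rewrite /adj /=; clear; lia.
        by clear -yT; lia.
      by rewrite xR in rR; clear -rR; lia.
    by rewrite mg //; move: e; rewrite /adj /=; clear -w1 wo; lia.
  + apply: Or43 => z /= zT; rewrite in_fsetD1 xpair_eqE mg; last by clear -zT; lia.
    by clear -zT; lia.
- have := cardfsD1 (w%:Z, T + 3) (grow w T A); rewrite tG (card_grow w1 gA).
  by move: #|` A| #|` _ `\ _| => x y; clear; lia.
Qed.

(** Only the two bottom corners are cut; the third cut will be made at the end of the strip. The
    second shape opens the hole (1, 1) at a cut corner: one hole and two tiles less at equal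
    semiperimeter, which shifts the parity of the hole count. *)
Lemma diag_ready N M h : (3 < N)%N -> (3 < M)%N -> diag_state N M h ->
  ready (N - 1) h (N * M - h - 2) /\ ready (N - 1) (h - 1) (N * M - h - 4).
Proof.
move=> N3 M3 [R [cR cc [n1 n2 n3]]]; have M2 := ltnW M3.
have N2 := ltnW N3; have N1 := ltnW N2; have M1 := ltnW M2.
pose K : {fset cell} := (N%:Z - 1, 0) |` [fset (0, 0)].
have [sR _] := cR; have Kc k : k \in K -> corner N M k.
  by rewrite !inE => /orP[] /eqP ->; rewrite /corner /=; clear; lia.
have Kb k : k \in K -> border N M k.
  by rewrite !inE /border mem_rect => /orP[] /eqP ->; rewrite /interior /=; clear -N1 M1; lia.
set A := rect N M `\` R `\` K.
have pA : polyomino A.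
  apply: (cut_diagonal (x' := N%:Z - 2) (y' := 1) N2 M2 cR) => //.
  - by apply: cut_corner; rewrite // !inE eqxx.
  - by move=> k; rewrite inE => /eqP ->; rewrite /corner /=; clear; lia.
  - by rewrite !inE xpair_eqE; clear -N1; lia.
  - by right.
  - by left.
have pR : pits A R by apply: sparse_pits.
have cA : (#|` A| = N * M - h - 2)%N.
  have := card_board sR Kb; rewrite -/A cc cardfs2.
  have -> : (N%:Z - 1, 0) != (0, 0) :> cell by rewrite xpair_eqE; clear -N1; lia.
  by move: (N * M)%N #|` A| => a b; rewrite /=; clear; lia.
have inA x y : (x, y) \notin R -> ~ (y = 0 /\ (x = 0 \/ x = N%:Z - 1)) ->
    0 <= x -> x < N%:Z -> 0 <= y -> y < M%:Z -> (x, y) \in A.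
  move=> xR xK *; rewrite in_fsetD mem_rectR xR !inE !xpair_eqE.
  apply/andP; split; last by lia.
  by clear -xK; lia.
have RI x y : (x, y) \in R -> [&& 0 < x, x + 1 < N%:Z, 0 < y & y + 1 < M%:Z].
  by move/sR.1.
have row x : 0 <= x -> x < N%:Z -> (x, M%:Z - 1) \in A.
  move=> x0 xN; apply: inA => //; [|clear -M1; lia..].
  by apply/negP => /RI; clear; lia.
have col y : 0 < y -> y < M%:Z -> (0, y) \in A.
  move=> y0 yM; apply: inA => //; [|clear -y0; lia|clear -N1; lia|exact: ltW].
  by apply/negP => /RI; clear; lia.
have dg : (1, M%:Z - 1 - 1) \in A.
  rewrite (_ : M%:Z - 1 - 1 = M%:Z - 2); last by clear; lia.
  by apply: inA; rewrite //; clear -N1 M3; lia.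
have top (c : cell) : c \in A -> c.2 <= M%:Z - 1.
  by case: c => x y; rewrite in_fsetD mem_rectR /=; clear; lia.
have gA : growable (N - 1) (M%:Z - 1) A R.
  split=> //; first by move=> x x0 xN; apply: row => //; clear -xN N1; lia.
  by apply: col; clear -M3; lia.
split; first by exists (M%:Z - 1), A, R.
have [] := open_corner pA pR _ _ n3 _ _.
- by move=> [x y]; rewrite in_fsetD mem_rectR /=; clear; lia.
- by rewrite in_fsetD !inE eqxx ?orbT.
- apply: inA; [|clear -N3; lia|clear; lia|clear -N2; lia|clear; lia|clear -M1; lia].
  by apply/negP => /RI; clear; lia.
- by apply: col; clear -M3; lia.
set B := A `\ _ `\ _; move=> pB pRB cB cRB.
exists (M%:Z - 1), B, (R `\ (1, 1)); split; last 2 first.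
- by move: cRB; rewrite -cc; move: #|` R `\ _| #|` R| => x y; clear; lia.
- by move: cB; rewrite cA; move: #|` B| (N * M)%N => x y; clear; lia.
have inB x y : (x, y) \in A -> 1 < y -> (x, y) \in B.
  by move=> xA y1; rewrite !in_fsetD1 xA !xpair_eqE; clear -y1; lia.
split=> //.
- by move=> c; rewrite !in_fsetD1 => /and3P[_ _ /top].
- by move=> x x0 xN; apply: inB; [apply: row|]; clear -x0 xN N1 M3; lia.
- by apply: inB; [apply: col|]; clear -M3; lia.
- by apply: inB => //; clear -M3; lia.
Qed.

(** * Doubling the scale *)

(* The even cells form a copy of the old box scaled by two, the odd cells are
   new holes, and the other cells are tiles subdividing the old adjacencies. *)
Definition odd_cells (N M : nat) : {fset cell} :=
  seq_fset tt [seq (((2 * i).+1%:Z, (2 * j).+1%:Z) : cell) | i <- iota 0 (N - 1), j <- iota 0 (M - 1)].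
Definition double_cell (c : cell) : cell := (2 * c.1, 2 * c.2).
Definition double_holes (N M : nat) (R : {fset cell}) : {fset cell} :=
  odd_cells N M `|` double_cell @` R.

Lemma mem_odd_cells N M x y : ((x, y) \in odd_cells N M) =
  [&& (x %% 2)%Z == 1, (y %% 2)%Z == 1, 0 < x, x < 2 * N%:Z - 2, 0 < y & y < 2 * M%:Z - 2].
Proof.
rewrite seq_fsetE; apply/allpairsP/idP => [[[i j] []]|H].
  by rewrite !mem_iota => h1 h2 [-> ->]; move: h1 h2 => /=; clear; lia.
exists (absz (x %/ 2)%Z, absz (y %/ 2)%Z); rewrite !mem_iota /=.
by split; try congr pair; clear -H; lia.
Qed.

Lemma card_odd_cells N M : #|` odd_cells N M| = ((N - 1) * (M - 1))%N.
Proof.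
rewrite size_seq_fset undup_id; first by rewrite size_allpairs !size_iota.
by apply: allpairs_uniq; rewrite ?iota_uniq // => -[i j] [k l] _ _ /= []; clear => *; congr pair; lia.
Qed.

Lemma mem_double_cell (R : {fset cell}) x y : ((x, y) \in double_cell @` R) =
  [&& (x %% 2)%Z == 0, (y %% 2)%Z == 0 & ((x %/ 2)%Z, (y %/ 2)%Z) \in R].
Proof.
apply/imfsetP/and3P => [[[z u] /= zR]|[x0 y0 xR]].
  move=> [-> ->]; split; [by clear; lia|by clear; lia|].
  by rewrite !mulKz.
exists ((x %/ 2)%Z, (y %/ 2)%Z) => //; rewrite /double_cell /=.
by congr pair; clear -x0 y0; lia.
Qed.

Lemma mem_double N M R x y : ((x, y) \in double_holes N M R) =
  [&& (x %% 2)%Z == 1, (y %% 2)%Z == 1, 0 < x, x < 2 * N%:Z - 2, 0 < y & y < 2 * M%:Z - 2]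
  || [&& (x %% 2)%Z == 0, (y %% 2)%Z == 0 & ((x %/ 2)%Z, (y %/ 2)%Z) \in R].
Proof. by rewrite in_fsetU mem_odd_cells mem_double_cell. Qed.

Lemma card_double N M R : #|` double_holes N M R| = ((N - 1) * (M - 1) + #|` R|)%N.
Proof.
rewrite cardfsU card_odd_cells card_imfset; last first.
  by move=> [x y] [z u] []; clear => *; congr pair; lia.
rewrite (_ : _ `&` _ = fset0) ?cardfs0 ?subn0 //.
apply/fsetP => -[x y]; rewrite in_fset0 in_fsetI mem_odd_cells mem_double_cell.
by apply/negP => /andP[/and5P[a _ _ _ _] /and3P[b _ _]]; clear -a b; lia.
Qed.

Lemma mem_corners3 N M x y : ((x, y) \in corners3 N M) =
  [|| (x == 0) && (y == 0), (x == 0) && (y == M%:Z - 1) | (x == N%:Z - 1) && (y == 0)].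
Proof. by rewrite !inE !xpair_eqE orbA. Qed.

(** With P = (N-1)(M-1), the relation 3h + 3 = P becomes 3(P + h) + 3 = 4P, the same relation for
    the doubled box. So doubling preserves the hypothesis of [cut_tight]. *)
Lemma cut_double N M h R : (2 < N)%N -> (2 < M)%N -> cut_state N M h R ->
  cut_state (2 * N - 1) (2 * M - 1) ((N - 1) * (M - 1) + h) (double_holes N M R).
Proof.
move=> N2 M2 [[Ri Ra] pA cc]; split; last by rewrite card_double cc.
  split=> [[x y]|[x y] [z u]]; rewrite !mem_double.
    case/orP => [H|/and3P[x0 y0 /Ri]]; rewrite /interior /=; first by clear -H N2 M2; lia.
    by clear -x0 y0 N2 M2; lia.
  move=> H1 H2; rewrite /adj /=; apply/negP => a.
  have p1 : (x %% 2)%Z = (y %% 2)%Z by case/orP: H1 => [/and3P[]|/and3P[]]; clear; lia.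
  have p2 : (z %% 2)%Z = (u %% 2)%Z by case/orP: H2 => [/and3P[]|/and3P[]]; clear; lia.
  by clear -p1 p2 a; lia.
set A := rect N M `\` R `\` corners3 N M in pA *.
set B := _ `\` _ `\` _.
have inA x y : ((x, y) \in A) = [&& ~~ [|| (x == 0) && (y == 0),
    (x == 0) && (y == M%:Z - 1) | (x == N%:Z - 1) && (y == 0)],
    (x, y) \notin R, 0 <= x, x < N%:Z, 0 <= y & y < M%:Z].
  by rewrite in_fsetD mem_corners3 mem_rectR.
have inB x y : ((x, y) \in B) = [&& ~~ [|| (x == 0) && (y == 0),
    (x == 0) && (y == 2 * M%:Z - 2) | (x == 2 * N%:Z - 2) && (y == 0)],
    (x, y) \notin double_holes N M R, 0 <= x, x < 2 * N%:Z - 1, 0 <= y & y < 2 * M%:Z - 1].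
  rewrite in_fsetD mem_corners3 mem_rectR.
  rewrite (_ : (2 * N - 1)%N%:Z = 2 * N%:Z - 1); last by clear -N2; lia.
  rewrite (_ : (2 * M - 1)%N%:Z = 2 * M%:Z - 1); last by clear -M2; lia.
  by rewrite -!addrA.
have RI x y : (x, y) \in R -> [&& 0 < x, x + 1 < N%:Z, 0 < y & y + 1 < M%:Z] by move/Ri.
have even x y : (x, y) \in A -> (2 * x, 2 * y) \in B.
  rewrite inA inB mem_double => H; have : (x, y) \notin R by case/and3P: H.
  by rewrite !mulKz // => /negbTE ->; clear -H; lia.
have mid x y : 0 <= x -> x < 2 * N%:Z - 1 -> 0 <= y -> y < 2 * M%:Z - 1 ->
    (x %% 2)%Z != (y %% 2)%Z -> (x, y) \in B.
  move=> x0 xN y0 yM p; rewrite inB mem_double.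
  by case: (_ \in R); rewrite ?andbF ?andbT; clear -x0 xN y0 yM p; lia.
(* Holes are pairwise non-adjacent, and corners touch neither holes nor each other; so every
   subdividing tile hangs on at least one old tile. *)
have one x y z u : adj (x, y) (z, u) -> 0 <= x -> x < N%:Z -> 0 <= y -> y < M%:Z ->
    0 <= z -> z < N%:Z -> 0 <= u -> u < M%:Z -> (x, y) \in A \/ (z, u) \in A.
  move=> a x0 xN y0 yM z0 zN u0 uM; apply/orP; rewrite !inA.
  have nR : ~~ (((x, y) \in R) && ((z, u) \in R)).
    by apply/negP => /andP[xR zR]; have := Ra _ _ xR zR; rewrite a.
  have := RI x y; have := RI z u; move: nR a; rewrite /adj /=.
  case: (_ \in R) (_ \in R) => [] [] //= _ a h1 h2.
  - by move: (h1 isT); clear -a x0 xN y0 yM z0 zN u0 uM N2 M2; lia.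
  - by move: (h2 isT); clear -a x0 xN y0 yM z0 zN u0 uM N2 M2; lia.
  - by clear -a x0 xN y0 yM z0 zN u0 uM N2 M2; lia.
have [[r1 r2] rA] := polyomino_nonempty pA.
have evl x y : (x, y) \in A -> lk B (2 * r1, 2 * r2) (2 * x, 2 * y).
  pose Q (c : cell) := lk B (2 * r1, 2 * r2) (2 * c.1, 2 * c.2).
  apply: (polyomino_ind (Q := Q) pA rA); first by apply: link_refl; apply: even.
  move=> [z u] [v w] zA vA a zl; apply: (link_trans zl) => /=.
  have mB : (z + v, u + w) \in B.
    move: zA vA a; rewrite !inA /adj /= => /and3P[_ _ zA] /and3P[_ _ vA] a.
    by apply: mid; clear -zA vA a; lia.
  have [zB vB] := (even _ _ zA, even _ _ vA).
  apply: (link_trans (link1 zB mB _) (link1 mB vB _)).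
    by move: a; rewrite /adj /=; clear; lia.
  by move: a; rewrite /adj /=; clear; lia.
apply: (polyomino_root (even _ _ rA)) => -[x y] xB.
have := xB; rewrite inB mem_double => H.
have [[xp yp]|[[xp yp]|[xp yp]]] : (x %% 2)%Z = 0 /\ (y %% 2)%Z = 0 \/
    (x %% 2)%Z = 1 /\ (y %% 2)%Z = 0 \/ (x %% 2)%Z = 0 /\ (y %% 2)%Z = 1.
  by move: H; case: (_ \in R); rewrite ?andbF ?andbT; clear; lia.
- have /evl : ((x %/ 2)%Z, (y %/ 2)%Z) \in A.
    by move: H; rewrite inA; case: (_ \in R); rewrite ?andbT ?andbF; clear -xp yp; lia.
  by rewrite (_ : 2 * (x %/ 2)%Z = x) 1?(_ : 2 * (y %/ 2)%Z = y) //; clear -xp yp; lia.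
- have [|||||||||/evl L|/evl L] := one (x %/ 2)%Z (y %/ 2)%Z ((x %/ 2)%Z + 1) (y %/ 2)%Z;
    try by move: H; rewrite /adj /=; clear -xp yp; lia.
  + have [_ LB] := link_in L; apply: (link_trans L (link1 LB xB _)).
    by rewrite /adj /=; clear -xp yp; lia.
  + have [_ LB] := link_in L; apply: (link_trans L (link1 LB xB _)).
    by rewrite /adj /=; clear -xp yp; lia.
- have [|||||||||/evl L|/evl L] := one (x %/ 2)%Z (y %/ 2)%Z (x %/ 2)%Z ((y %/ 2)%Z + 1);
    try by move: H; rewrite /adj /=; clear -xp yp; lia.
  + have [_ LB] := link_in L; apply: (link_trans L (link1 LB xB _)).
    by rewrite /adj /=; clear -xp yp; lia.
  + have [_ LB] := link_in L; apply: (link_trans L (link1 LB xB _)).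
    by rewrite /adj /=; clear -xp yp; lia.
Qed.

Lemma double_corners N M R : (2 < N)%N -> (2 < M)%N ->
  (1, 1) \in double_holes N M R /\ (1, (2 * M - 1)%N%:Z - 2) \in double_holes N M R.
Proof. by move=> N2 M2; rewrite !mem_double; clear -N2 M2; lia. Qed.

(** Opening a hole at a cut corner trades one hole for two tiles and keeps the semiperimeter, hence
    tightness. This is done at (0, 0), then after a reflection at (0, M - 1). *)
Lemma cut_open N M h R : (4 < N)%N -> (6 < M)%N -> (3 * h + 3 = (N - 1) * (M - 1))%N ->
  cut_state N M h R -> (1, 1) \in R -> (1, M%:Z - 2) \in R ->
  tight (N + M) (h - 1) /\ tight (N + M) (h - 2).
Proof.
move=> N4 M6 D [sR pA cc] r1 r2; have N1 : (1 < N)%N by clear -N4; lia.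
have M1 : (1 < M)%N by clear -M6; lia.
have Kb k : k \in corners3 N M -> border N M k.
  case: k => x y; rewrite mem_corners3 /border mem_rect /interior /=.
  by clear -N1 M1; lia.
have := card_board sR Kb; rewrite card_corners3 // cc.
have : pits (rect N M `\` R `\` corners3 N M) R.
  by apply: sparse_pits => // k; apply: corners3_corner.
set A := rect N M `\` R `\` corners3 N M in pA * => pR cA.
have inA x y : ((x, y) \in A) = [&& ~~ [|| (x == 0) && (y == 0),
    (x == 0) && (y == M%:Z - 1) | (x == N%:Z - 1) && (y == 0)],
    (x, y) \notin R, 0 <= x, x < N%:Z, 0 <= y & y < M%:Z].
  by rewrite in_fsetD mem_corners3 mem_rectR.
have RI x y : (x, y) \in R -> [&& 0 < x, x + 1 < N%:Z, 0 < y & y + 1 < M%:Z].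
  by move/sR.1.
have side x y : x = 0 \/ y = 0 \/ y = M%:Z - 1 -> (x, y) \notin R.
  by move=> H; apply/negP => /RI; clear -H; lia.
have t20 : (2, 0) \in A by rewrite inA side; [clear -N4 M6; lia|right; left].
have t02 : (0, 2) \in A by rewrite inA side; [clear -N4 M6; lia|left].
have [] := open_corner pA pR _ _ r1 t20 t02.
- by move=> [x y]; rewrite inA /=; clear; lia.
- by rewrite inA !eqxx.
set B := A `\ _ `\ _; set S := R `\ _; move=> pB pS cB cS.
have cN : (3 * h + 3 + N + M = N * M + 1)%N by clear -D N1 M1; nia.
split.
  exists B; split=> //.
    by rewrite (_ : (h - 1)%N = #|` S|); [apply: pits_num|rewrite -cc -cS addnK].
  move: cS cB cA cN; rewrite cc; move: #|` S| #|` B| #|` A| => s b a.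
  by move: (N * M)%N => z; clear -M6; lia.
have i := iso_flipy (M%:Z - 1).
have inB x y : ((x, y) \in flipy (M%:Z - 1) @` B) =
    [&& ~~ ((x == 0) && (M%:Z - 1 - y == 1)), ~~ ((x == 1) && (M%:Z - 1 - y == 0)) &
      (x, M%:Z - 1 - y) \in A].
  by rewrite mem_flipy !in_fsetD1 !xpair_eqE.
have [] := open_corner (polyomino_iso i pB) (pits_iso i pS).
- by move=> [x y]; rewrite inB inA /=; clear; lia.
- by rewrite inB inA !subr0 !eqxx ?orbT ?andbF.
- rewrite mem_flipy in_fsetD1 (_ : M%:Z - 1 - 1 = M%:Z - 2); last by clear; lia.
  by rewrite r2 xpair_eqE; clear -M6; lia.
- by rewrite inB inA side; [clear -N4 M6; lia|right; right; clear; lia].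
- by rewrite inB inA side; [clear -N4 M6; lia|left].
set B' := _ `\ (1, 0) `\ (0, 1); set S' := _ `\ (1, 1) => pB' pS' cB' cS'.
exists B'; split=> //.
  rewrite (_ : (h - 2)%N = #|` S'|); first exact: pits_num.
  move: cS'; rewrite (card_iso i); move: cS; rewrite cc.
  by move: #|` S| #|` S'| => a b; clear; lia.
move: cB'; rewrite (card_iso i); move: cB cA cN cS cS'; rewrite (card_iso i) cc.
move: #|` B'| #|` B| #|` A| #|` S| #|` S'| => a b c d e.
by move: (N * M)%N => z; clear -M6; lia.
Qed.

(** * Tight polyominoes for every h of a range *)

Lemma opt_eq q r N M : (r < 3)%N -> ((N - 1) * (M - 1) = 3 * q + r)%N ->
  opt N M = (q - 1)%N.
Proof. by move=> r3; rewrite /opt => ->; rewrite mulnC divnMDl // divn_small ?addn0. Qed.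

(** Here [s] is the semiperimeter after one more strip: adding [w] holes and [2w + 2] tiles turns
    this equation into tightness. *)
Definition ready_tight (a s h : nat) : Prop := exists2 n, ready a h n & (n + 3 = 2 * h + s)%N.

Lemma ready_tight_diag q E M : ~~ odd E -> ~~ odd M -> (3 < E)%N -> (3 < M)%N ->
  ((E - 1) * (M - 1) = 3 * q)%N -> ready_tight (E - 1) (E + M + 3) (q - 1) /\
  ready_tight (E - 1) (E + M + 3) (q - 2).
Proof.
move=> Ee Me E3 M3 D; have d := diag_opt Ee Me E3 M3.
rewrite (@opt_eq q 0) ?addn0 // in d; have [r1 r2] := diag_ready E3 M3 d.
have H : (E * M + 1 = 3 * q + E + M)%N by clear -D E3 M3; nia.
have q2 : (2 < q)%N by clear -D E3 M3; nia.
rewrite -subnDA in r2; move: (E * M)%N H r1 r2 => z H r1 r2.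
by split; eexists; [exact: r1| |exact: r2|]; clear -H q2; lia.
Qed.

Lemma ready_tight_grow a s h : odd a -> (1 < a)%N -> ready_tight a s h ->
  ready_tight a (s + 3) (h + a).
Proof.
move=> ao a1 [n rn e]; exists (n + 2 * a + 3)%N; first exact: ready_grow.
by clear -e; lia.
Qed.

Lemma ready_tight_strip a s h w : odd w -> (1 < w <= a)%N -> ready_tight a s h ->
  tight s (h + w).
Proof.
move=> wo wa [n rn e]; have [A [pA nA cA]] := ready_strip rn wo wa.
by exists A; split=> //; rewrite cA; clear -e; lia.
Qed.

(** Strip widths are odd and at least 3. Those started from [h0] reach one parity and those started
    from [h0 - 1] the other, so together they leave no gap from [h0 + 2] to [h0 + a]. *)
Lemma ready_tight_range a s h0 h : odd a -> (0 < h0)%N -> ready_tight a s h0 ->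
  ready_tight a s (h0 - 1) -> (h0 + 2 <= h <= h0 + a)%N -> tight s h.
Proof.
move=> ao h1 r0 r1 H; have [o|e] := boolP (odd (h - h0)).
  rewrite (_ : h = h0 + (h - h0))%N; last by clear -H; lia.
  by apply: (ready_tight_strip o _ r0); clear -H; lia.
rewrite (_ : h = h0 - 1 + (h - h0 + 1))%N; last by clear -H h1; lia.
by apply: (ready_tight_strip _ _ r1); clear -H ao e; lia.
Qed.

Lemma tight_one_strip q E M h : ~~ odd E -> ~~ odd M -> (3 < E)%N -> (3 < M)%N ->
  ((E - 1) * (M - 1) = 3 * q)%N -> (q + 1 <= h)%N -> (h + 2 <= q + E)%N ->
  tight (E + M + 3) h.
Proof.
move=> Ee Me E3 M3 D h1 h2; have [r1 r2] := ready_tight_diag Ee Me E3 M3 D.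
have q1 : (1 < q)%N by clear -D E3 M3; nia.
apply: (ready_tight_range _ _ r1); [clear -Ee E3; lia|clear -q1; lia| |clear -h1 h2 q1; lia].
by rewrite -subnDA.
Qed.

Lemma tight_two_strips q E M h : ~~ odd E -> ~~ odd M -> (3 < E)%N -> (3 < M)%N ->
  ((E - 1) * (M - 1) = 3 * q)%N -> (q + E <= h)%N -> (h + 3 <= q + 2 * E)%N ->
  tight (E + M + 6) h.
Proof.
move=> Ee Me E3 M3 D h1 h2; have [r1 r2] := ready_tight_diag Ee Me E3 M3 D.
have q1 : (1 < q)%N by clear -D E3 M3; nia.
have Eo : odd (E - 1) by clear -Ee E3; lia.
have E1 : (1 < E - 1)%N by clear -E3; lia.
have := ready_tight_grow Eo E1 r1; have := ready_tight_grow Eo E1 r2.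
rewrite (_ : E + M + 3 + 3 = E + M + 6)%N; last by clear; lia.
move=> g2 g1; apply: (ready_tight_range Eo _ g1); [clear -q1; lia| |clear -h1 h2 q1 E3; lia].
by rewrite (_ : q - 1 + (E - 1) - 1 = q - 2 + (E - 1))%N //; clear -q1; lia.
Qed.

Lemma tight_opt_even q E M : ~~ odd E -> ~~ odd M -> (3 < E)%N -> (3 < M)%N ->
  ((E - 1) * (M - 1) = 3 * q)%N -> tight (E + M) (q - 1).
Proof.
move=> Ee Me E3 M3 D; have d := diag_opt Ee Me E3 M3.
rewrite (@opt_eq q 0) ?addn0 // in d.
have [R cR] := cut_diag (ltnW E3) (ltnW M3) d.
by apply: (cut_tight _ _ _ cR); clear -E3 M3 D; nia.
Qed.

(** A box chosen to be doubled: 2a - 1 and 2b - 1 add up to 4n, the semiperimeter of the square of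
    side 2n. For [n = 4] the 5 x 4 strip serves. *)
Lemma cut_near n : (2 < n)%N -> (n %% 3 != 2)%N -> exists a b R,
  [/\ (2 < a)%N, (2 < b)%N, (a + b = 2 * n + 1)%N, ((a - 1) * (b - 1) = (n - 1) * n)%N
    & cut_state a b (opt a b) R].
Proof.
move=> n2 n3; have [n3'|n3'] := eqVneq n 3%N.
  by have [//|//|R cR] := @cut_strip 3; exists 3, 4, R; rewrite n3'.
have [n4|n4] := eqVneq n 4%N.
  by have [//|//|R cR] := @cut_strip 5; exists 5, 4, R; rewrite n4.
have n6 : (5 < n)%N by clear -n2 n3 n3' n4; lia.
have [o|e] := boolP (odd n).
  have [R cR] : exists R, cut_state (n + 1) n (opt (n + 1) n) R.
    by apply: cut_side => //; [|apply: side_opt => //]; clear -n6 o; lia.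
  by exists (n + 1)%N, n, R; split=> //; clear -n6; nia.
have [R cR] : exists R, cut_state n (n + 1) (opt n (n + 1)) R.
  by apply: cut_side => //; [|apply: side_opt => //]; clear -n6 e; lia.
by exists n, (n + 1)%N, R; split=> //; clear -n6; nia.
Qed.

(** For the square, (2n-1)^2 = 4n(n-1) + 1 is not divisible by 3. The doubled box of equal
    semiperimeter has product 4n(n-1), which is divisible by 3 and yields the same [opt]. *)
Lemma tight_even_square n : (2 < n)%N -> (n %% 3 != 2)%N ->
  tight (4 * n) (opt (2 * n) (2 * n)).
Proof.
move=> n2 n3; have [a [b [R [a2 b2 ab D cR]]]] := cut_near n2 n3.
have [q Dq] : exists q, ((n - 1) * n = 3 * q)%N.
  have : (3 %| (n - 1) * n)%N.
    by rewrite Euclid_dvdM //; apply/orP; rewrite /dvdn; clear -n2 n3; lia.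
  by case/dvdnP => q Dq; exists q; rewrite Dq mulnC.
have q2 : (1 < q)%N by clear -Dq n2; nia.
rewrite Dq in D; rewrite (@opt_eq q 0) ?addn0 // in cR.
have cD := cut_double a2 b2 cR; rewrite D in cD.
rewrite (_ : 4 * n = 2 * a - 1 + (2 * b - 1))%N; last by clear -ab a2 b2; lia.
rewrite (@opt_eq (4 * q) 1) //; last by clear -Dq n2; nia.
rewrite (_ : 4 * q - 1 = 3 * q + (q - 1))%N; last by clear -q2; lia.
by apply: (cut_tight _ _ _ cD); clear -D q2 a2 b2; nia.
Qed.

Lemma cut_square m : (m %% 3 = 1)%N -> (3 < m)%N -> exists R, cut_state m m (opt m m) R.
Proof.
elim/ltn_ind: m => m IH m1 m3; have [o|e] := boolP (odd m); last first.
  by apply: cut_diag; [exact: ltnW|exact: ltnW|apply: diag_opt].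
(* Halving an odd side: with m = 6k + 1 the side to be doubled is 3k + 1, again 1 modulo 3, and
   twice it minus 1 is m. *)
have [|||R cR] := IH (m./2.+1); [by clear -m1 m3 o; lia..|].
have n2 : (2 < m./2.+1)%N by clear -m1 m3 o; lia.
have cD := cut_double n2 n2 cR.
rewrite (_ : 2 * m./2.+1 - 1 = m)%N in cD; last by clear -o; lia.
have [k mk] : exists k, m = (6 * k + 1)%N by exists (m %/ 6)%N; clear -o m1; lia.
have h2 : m./2.+1 = (3 * k + 1)%N by clear -mk; lia.
exists (double_holes m./2.+1 m./2.+1 R); move: cD; congr cut_state.
rewrite h2 mk (@opt_eq (3 * (k * k)) 0) //; last by clear; nia.
rewrite (@opt_eq (12 * (k * k)) 0) //; last by clear; nia.
have : (0 < k)%N by clear -mk m3; lia.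
by clear; nia.
Qed.

(** Two strips stop three short of [opt] for this square. Doubling gives the top value, and opening
    one or two corners of the doubled shape gives the next two. *)
Lemma tight_odd_square m h : (m %% 3 = 1)%N -> (3 < m)%N ->
  (opt (2 * m - 1) (2 * m - 1) <= h + 2)%N -> (h <= opt (2 * m - 1) (2 * m - 1))%N ->
  tight (2 * (2 * m - 1)) h.
Proof.
move=> m1 m3; have m2 := ltnW m3; have [R cR] := cut_square m1 m3.
have cD := cut_double m2 m2 cR; have [r1 r2] := double_corners R m2 m2.
have [k mk] : exists k, m = (3 * k + 1)%N by exists (m %/ 3)%N; clear -m1; lia.
have k0 : (0 < k)%N by clear -mk m3; lia.
have o1 : opt m m = (3 * (k * k) - 1)%N.
  by rewrite (@opt_eq (3 * (k * k)) 0) // mk; clear; nia.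
have o2 : opt (2 * m - 1) (2 * m - 1) = (12 * (k * k) - 1)%N.
  by rewrite (@opt_eq (12 * (k * k)) 0) // mk; clear; nia.
have D : (3 * ((m - 1) * (m - 1) + opt m m) + 3 =
    (2 * m - 1 - 1) * (2 * m - 1 - 1))%N by rewrite o1 mk; clear -k0; nia.
have e : ((m - 1) * (m - 1) + opt m m = 12 * (k * k) - 1)%N.
  by rewrite o1 mk; clear -k0; nia.
rewrite e in cD D; have n1 : (1 < 2 * m - 1)%N by clear -m3; lia.
rewrite o2 mul2n -addnn => h1 h2.
have [->|h3] := eqVneq h (12 * (k * k) - 1)%N; first exact: (cut_tight n1 n1 D cD).
have [||t1 t2] := cut_open _ _ D cD r1 r2; [clear -m3; lia..|].
have [->|h4] := eqVneq h (12 * (k * k) - 1 - 1)%N; first exact: t1.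
by rewrite (_ : h = 12 * (k * k) - 1 - 2)%N //; clear -h1 h2 h3 h4; lia.
Qed.

(** In each class modulo 6 two strips are put on an even box E x M with E + M + 6 = 2N and one side
    1 modulo 3; the constant passed to [tight_two_strips] is (E-1)(M-1)/3. This misses three values
    for residue 1 and one value for residues 2 and 0, which doubling supplies. The small cases use 4
    x 4, 4 x 6 and 4 x 8 boxes. *)
Lemma tight_square N h : (1 < h)%N -> (opt (N - 1) N < h)%N -> (h <= opt N N)%N ->
  tight (2 * N) h.
Proof.
move=> h0; have [N6|N6] := leqP N 6.
  move: N6; do 7?[case: N => [|N]] => //= _; rewrite /opt /= => h1 h2; try lia.
  - rewrite (_ : h = 3 - 1)%N; last by lia. 
    by apply: (@tight_opt_even 3 4 4).
  - rewrite (_ : h = 5 - 1)%N; last by lia.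
    by apply: (@tight_opt_even 5 4 6).
  - have [->|h7] := eqVneq h 7%N; first exact: (@tight_even_square 3).
    rewrite (_ : h = 7 - 1)%N; last by lia.
    by apply: (@tight_opt_even 7 4 8).
(* Residues are taken from 7 to 12 so that the auxiliary sides, at least 6k + 4, are large enough
   already for [k = 0]. *)
have [k [r [-> r7]]] : exists k r, N = (6 * k + r)%N /\ (6 < r < 13)%N.
  by exists ((N - 7) %/ 6)%N, (7 + (N - 7) %% 6)%N; clear -N6; lia.
have hr : [|| r == 7, r == 8, r == 9, r == 10, r == 11 | r == 12]%N by clear -r7; lia.
set kk := (k * k)%N; clear N N6 r7.
case/or4P: hr => [/eqP->|/eqP->|/eqP->|/or3P[]/eqP->] h1 h2.
- have [h3|h3] := leqP (opt (6 * k + 7) (6 * k + 7)) (h + 2).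
    rewrite (_ : 6 * k + 7 = 2 * (3 * k + 4) - 1)%N in h2 h3 *; last by clear; lia.
    by apply: tight_odd_square => //; clear; lia.
  rewrite (_ : 2 * _ = 6 * k + 4 + (6 * k + 4) + 6)%N; last by clear; lia.
  rewrite (@opt_eq (12 * kk + 22 * k + 10) 0) // in h1; last by rewrite /kk; clear; nia.
  rewrite (@opt_eq (12 * kk + 24 * k + 12) 0) // in h3; last by rewrite /kk; clear; nia.
  apply: (@tight_two_strips (12 * kk + 12 * k + 3)); rewrite /kk; clear -h1 h3; nia.
- have [->|h3] := eqVneq h (opt (6 * k + 8) (6 * k + 8)).
    rewrite (_ : 2 * (6 * k + 8) = 4 * (3 * k + 4))%N; last by clear; lia.
    rewrite (_ : 6 * k + 8 = 2 * (3 * k + 4))%N; last by clear; lia.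
    by apply: tight_even_square; clear; lia.
  rewrite (_ : 2 * _ = 6 * k + 6 + (6 * k + 4) + 6)%N; last by clear; lia.
  rewrite (@opt_eq (12 * kk + 26 * k + 14) 0) // in h1; last by rewrite /kk; clear; nia.
  rewrite (@opt_eq (12 * kk + 28 * k + 16) 1) // in h2 h3; last by rewrite /kk; clear; nia.
  apply: (@tight_two_strips (12 * kk + 16 * k + 5)); rewrite /kk; clear -h1 h2 h3; nia.
- rewrite (_ : 2 * _ = 6 * k + 8 + (6 * k + 4) + 6)%N; last by clear; lia.
  rewrite (@opt_eq (12 * kk + 30 * k + 18) 2) // in h1; last by rewrite /kk; clear; nia.
  rewrite (@opt_eq (12 * kk + 32 * k + 21) 1) // in h2; last by rewrite /kk; clear; nia.
  apply: (@tight_two_strips (12 * kk + 20 * k + 7)); rewrite /kk; clear -h1 h2; nia.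
- rewrite (_ : 2 * _ = 6 * k + 10 + (6 * k + 4) + 6)%N; last by clear; lia.
  rewrite (@opt_eq (12 * kk + 34 * k + 24) 0) // in h1; last by rewrite /kk; clear; nia.
  rewrite (@opt_eq (12 * kk + 36 * k + 27) 0) // in h2; last by rewrite /kk; clear; nia.
  apply: (@tight_two_strips (12 * kk + 24 * k + 9)); rewrite /kk; clear -h1 h2; nia.
- rewrite (_ : 2 * _ = 6 * k + 10 + (6 * k + 6) + 6)%N; last by clear; lia.
  rewrite (@opt_eq (12 * kk + 38 * k + 30) 0) // in h1; last by rewrite /kk; clear; nia.
  rewrite (@opt_eq (12 * kk + 40 * k + 33) 1) // in h2; last by rewrite /kk; clear; nia.
  apply: (@tight_two_strips (12 * kk + 28 * k + 15)); rewrite /kk; clear -h1 h2; nia.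
- have [->|h3] := eqVneq h (opt (6 * k + 12) (6 * k + 12)).
    rewrite (_ : 2 * (6 * k + 12) = 4 * (3 * k + 6))%N; last by clear; lia.
    rewrite (_ : 6 * k + 12 = 2 * (3 * k + 6))%N; last by clear; lia.
    by apply: tight_even_square; clear; lia.
  rewrite (_ : 2 * _ = 6 * k + 10 + (6 * k + 8) + 6)%N; last by clear; lia.
  rewrite (@opt_eq (12 * kk + 42 * k + 36) 2) // in h1; last by rewrite /kk; clear; nia.
  rewrite (@opt_eq (12 * kk + 44 * k + 40) 1) // in h2 h3; last by rewrite /kk; clear; nia.
  apply: (@tight_two_strips (12 * kk + 32 * k + 21)); rewrite /kk; clear -h1 h2 h3; nia.
Qed.

(** Here one strip on an even box with E + M + 3 = 2N + 1 reaches the whole range in every class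
    modulo 6. *)
Lemma tight_rectangle N h : (1 < h)%N -> (opt N N < h)%N -> (h <= opt N (N + 1))%N ->
  tight (2 * N + 1) h.
Proof.
move=> h0; have [N4|N4] := leqP N 4.
  move: N4; do 5?[case: N => [|N]] => //= _; rewrite /opt /= => h1 h2; try lia.
  rewrite (_ : h = 3)%N; last by lia.
  have [//|//|R cR] := @cut_strip 5; exact: (@cut_tight 5 4 3 R).
have [k [r [-> r5]]] : exists k r, N = (6 * k + r)%N /\ (4 < r < 11)%N.
  by exists ((N - 5) %/ 6)%N, (5 + (N - 5) %% 6)%N; clear -N4; lia.
have hr : [|| r == 5, r == 6, r == 7, r == 8, r == 9 | r == 10]%N by clear -r5; lia.
set kk := (k * k)%N; clear N N4 r5.
case/or4P: hr => [/eqP->|/eqP->|/eqP->|/or3P[]/eqP->] h1 h2.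
- rewrite (_ : 2 * _ + 1 = 6 * k + 4 + (6 * k + 4) + 3)%N; last by clear; lia.
  rewrite (@opt_eq (12 * kk + 16 * k + 5) 1) // in h1; last by rewrite /kk; clear; nia.
  rewrite (@opt_eq (12 * kk + 18 * k + 6) 2) // in h2; last by rewrite /kk; clear; nia.
  apply: (@tight_one_strip (12 * kk + 12 * k + 3)); rewrite /kk; clear -h1 h2; nia.
- rewrite (_ : 2 * _ + 1 = 6 * k + 6 + (6 * k + 4) + 3)%N; last by clear; lia.
  rewrite (@opt_eq (12 * kk + 20 * k + 8) 1) // in h1; last by rewrite /kk; clear; nia.
  rewrite (@opt_eq (12 * kk + 22 * k + 10) 0) // in h2; last by rewrite /kk; clear; nia.
  apply: (@tight_one_strip (12 * kk + 16 * k + 5)); rewrite /kk; clear -h1 h2; nia.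
- rewrite (_ : 2 * _ + 1 = 6 * k + 8 + (6 * k + 4) + 3)%N; last by clear; lia.
  rewrite (@opt_eq (12 * kk + 24 * k + 12) 0) // in h1; last by rewrite /kk; clear; nia.
  rewrite (@opt_eq (12 * kk + 26 * k + 14) 0) // in h2; last by rewrite /kk; clear; nia.
  apply: (@tight_one_strip (12 * kk + 20 * k + 7)); rewrite /kk; clear -h1 h2; nia.
- rewrite (_ : 2 * _ + 1 = 6 * k + 10 + (6 * k + 4) + 3)%N; last by clear; lia.
  rewrite (@opt_eq (12 * kk + 28 * k + 16) 1) // in h1; last by rewrite /kk; clear; nia.
  rewrite (@opt_eq (12 * kk + 30 * k + 18) 2) // in h2; last by rewrite /kk; clear; nia.
  apply: (@tight_one_strip (12 * kk + 24 * k + 9)); rewrite /kk; clear -h1 h2; nia.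
- rewrite (_ : 2 * _ + 1 = 6 * k + 10 + (6 * k + 6) + 3)%N; last by clear; lia.
  rewrite (@opt_eq (12 * kk + 32 * k + 21) 1) // in h1; last by rewrite /kk; clear; nia.
  rewrite (@opt_eq (12 * kk + 34 * k + 24) 0) // in h2; last by rewrite /kk; clear; nia.
  apply: (@tight_one_strip (12 * kk + 28 * k + 15)); rewrite /kk; clear -h1 h2; nia.
- rewrite (_ : 2 * _ + 1 = 6 * k + 10 + (6 * k + 8) + 3)%N; last by clear; lia.
  rewrite (@opt_eq (12 * kk + 36 * k + 27) 0) // in h1; last by rewrite /kk; clear; nia.
  rewrite (@opt_eq (12 * kk + 38 * k + 30) 0) // in h2; last by rewrite /kk; clear; nia.
  apply: (@tight_one_strip (12 * kk + 32 * k + 21)); rewrite /kk; clear -h1 h2; nia.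
Qed.

(** * Minimal boxes *)

Lemma ex_is_min (P : nat -> Prop) n : P n -> exists m, is_min P m.
Proof.
elim/ltn_ind: n => n IH Pn.
have [[k [kn Pk]]|H] := classic (exists k, (k < n)%N /\ P k); first exact: IH kn Pk.
exists n; split=> // k Pk; rewrite leqNgt; apply/negP => kn; apply: H.
by exists k.
Qed.

Lemma ex_is_max (P : nat -> Prop) n b : P n -> (forall k, P k -> (k <= b)%N) ->
  exists m, is_max P m.
Proof.
move=> Pn Pb; have [|m [Pm Hm]] := @ex_is_min (fun j => P (b - j)%N) (b - n).
  by rewrite subKn ?Pb.
exists (b - m)%N; split=> // k Pk; have kb := Pb _ Pk.
have : (m <= b - k)%N by apply: Hm; rewrite subKn.
by clear -kb; lia.
Qed.

(** If a column between two tiles were empty, adjacency could never cross it. The integer [m] is the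
    largest abscissa, so that [flipx m] moves the polyomino against the axis. *)
Lemma cols_span A : polyomino A -> exists m : int,
  forall c : cell, c \in A -> (0 <= m - c.1) && (m - c.1 < (#|` cols A|)%:Z).
Proof.
move=> pA; have [A0 _] := pA.
have [[m y] mA mm] := fset_argmin (fun c : cell => - c.1) A0.
exists m => -[x z] xA; have /= xm := mm _ xA; apply/andP; split => /=.
  by clear -xm; lia.
have all u : x <= u -> u <= m -> u \in cols A.
  move=> xu um; apply: contraT => nu.
  have side c : c \in A -> c.1 != u.
    by move=> cA; apply: contraNneq nu => <-; apply/imfsetP; exists c.
  have : m < u.
    apply: (polyomino_ind (Q := fun c : cell => c.1 < u) pA xA _ _ mA) => [|[a b] [c d]] /=.
      by have /= := side _ xA; clear -xu; lia.
    by move=> _ /side /=; rewrite /adj /=; clear; lia.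
  by clear -um; lia.
have : (absz (m - x + 1)%R <= #|` cols A|)%N.
  by apply: (@card_int_range _ x) => u xu um; apply: all => //; clear -um xm; lia.
by move: #|` cols A| => n; clear -xm; lia.
Qed.

Lemma bounding_box A h : polyomino A -> num_holes A h -> exists B,
  [/\ polyomino B, in_rect #|` cols A| #|` rows A| B & num_holes B h].
Proof.
move=> pA nh; have [m Hm] := cols_span pA.
have [m'] := cols_span (polyomino_iso iso_swap pA); rewrite cols_swap => Hm'.
have i := iso_flipx m; have i' := iso_flipy m'.
exists (flipy m' @` (flipx m @` A)); split.
- exact/(polyomino_iso i')/(polyomino_iso i).
- move=> [x y]; rewrite mem_flipy mem_flipx => cA.
  have /andP[/= h1 h2] := Hm _ cA.
  have /Hm'/andP[/= h3 h4] : (m' - y, m - x) \in swap @` A by rewrite mem_swap.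
  by apply/and4P; split; clear -h1 h2 h3 h4; lia.
- exact/(num_holes_iso i' i')/(num_holes_iso i i).
Qed.

Lemma config_polyomino N M R : config N M R ->
  exists A, [/\ polyomino A, in_rect N M A & num_holes A #|` R|].
Proof.
move=> cR; exists (rect N M `\` R); split; [by case: cR| |exact/pits_num/config_pits].
by move=> c; rewrite in_fsetD mem_rect => /andP[].
Qed.

Lemma in_rect_bound N M A h : polyomino A -> in_rect N M A -> num_holes A h ->
  (0 < h)%N -> (3 * h + 1 <= (N - 1) * (M - 1))%N.
Proof.
move=> pA Ar nh h0; have [R cR cc] := config_of_polyomino pA Ar nh h0.
by rewrite -cc; apply: config_bound => //; rewrite -cardfs_gt0 cc.
Qed.

Lemma polyomino_tile : polyomino [fset (0, 0)] /\ num_holes [fset (0, 0)] 0.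
Proof.
split.
  apply: (@polyomino_root _ (0, 0)); first by rewrite inE.
  by move=> c; rewrite inE => /eqP ->; apply: link_refl; rewrite inE.
have p : pits [fset (0, 0)] fset0; last by have := pits_num p; rewrite cardfs0.
split=> [r|r d|[x y]]; rewrite ?in_fset0 // in_fset1 xpair_eqE => xy _.
have [x0|[x0|[y0|y0]]] : x < 0 \/ 0 < x \/ y < 0 \/ 0 < y by clear -xy; lia.
- by apply: Or42 => z /= zx; rewrite in_fset1 xpair_eqE; clear -x0 zx; lia.
- by apply: Or41 => z /= zx; rewrite in_fset1 xpair_eqE; clear -x0 zx; lia.
- by apply: Or44 => z /= zx; rewrite in_fset1 xpair_eqE; clear -y0 zx; lia.
- by apply: Or43 => z /= zx; rewrite in_fset1 xpair_eqE; clear -y0 zx; lia.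
Qed.

Lemma hmax_ex N M : (0 < N)%N -> (0 < M)%N -> exists m, hmax_is N M m.
Proof.
move=> N0 M0; apply: (@ex_is_max _ 0 (N * M)).
  exists [fset (0, 0)]; have [p n] := polyomino_tile; split=> //.
  by move=> c; rewrite inE => /eqP -> /=; clear -N0 M0; lia.
move=> [|k] // [A [pA Ar nh]]; have := in_rect_bound pA Ar nh isT.
by clear; nia.
Qed.

Lemma hmax_config N M m R : hmax_is N M m -> config N M R -> (#|` R| <= m)%N.
Proof. by move=> [_ H] /config_polyomino[A HA]; apply: H; exists A. Qed.

Lemma hmax_opt N b m : (b <= 1)%N -> hmax_is N (N + b) m -> (opt N (N + b) <= m)%N.
Proof.
move=> b1 H; case: (posnP (opt N (N + b))) => [->//|o0].
by have [R cR <-] := has_config_opt b1 o0; apply: hmax_config H cR.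
Qed.

Lemma in_rect_swap N M A h : polyomino A -> in_rect N M A -> num_holes A h ->
  exists B, [/\ polyomino B, in_rect M N B & num_holes B h].
Proof.
move=> pA Ar nh; exists (swap @` A); split.
- exact: (polyomino_iso iso_swap pA).
- by move=> [x y]; rewrite mem_swap => /Ar /=; clear; lia.
- exact: (num_holes_iso iso_swap iso_swap).
Qed.

Definition minimal_box (N b h : nat) : Prop := forall N' b' ha', (b' <= 1)%N -> (1 <= N')%N ->
  (N' * (N' + b') < N * (N + b))%N -> hmax_is N' (N' + b') ha' -> (ha' < h)%N.

(** The side count leaves the product at least 3h + 1 while [opt] requires 3h + 3; the residues of
    squares, and below of pronic numbers, exclude intermediate values. *)
Lemma square_mod3 c h : (3 * h + 2 != c * c)%N.
Proof.
have [k [r [-> r3]]] : exists k r, c = (3 * k + r)%N /\ (r < 3)%N.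
  by exists (c %/ 3)%N, (c %% 3)%N; clear; lia.
have : [|| r == 0, r == 1 | r == 2]%N by clear -r3; lia.
by clear r3; case/or3P => /eqP ->; apply/eqP; nia.
Qed.

Lemma pronic_mod3 c h : (3 * h + 1 != c * (c + 1))%N.
Proof.
have [k [r [-> r3]]] : exists k r, c = (3 * k + r)%N /\ (r < 3)%N.
  by exists (c %/ 3)%N, (c %% 3)%N; clear; lia.
have : [|| r == 0, r == 1 | r == 2]%N by clear -r3; lia.
by clear r3; case/or3P => /eqP ->; apply/eqP; nia.
Qed.

Lemma opt_ge N M h : (3 * h + 3 <= (N - 1) * (M - 1))%N -> (h <= opt N M)%N.
Proof. by rewrite /opt; move: ((N - 1) * (M - 1))%N => P; clear; lia. Qed.

(** Compare the bounding box p x q with the balanced box n x (n + e) of equal semiperimeter, whose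
    alpha is smaller. Unless they coincide up to a swap, the product (p-1)(q-1) is at least 1
    smaller if [e = 0] and at least 2 smaller if [e = 1]; for [e = 0], [square_mod3] closes the
    remaining gap. Then h <= [opt] of the balanced box, against minimality. *)
Lemma minimal_semiperimeter N b h A : (b <= 1)%N -> (1 <= N)%N -> (0 < h)%N ->
  minimal_box N b h -> polyomino A -> num_holes A h ->
  (2 * N + b <= #|` cols A| + #|` rows A|)%N.
Proof.
move=> b1 N1 h0 Hmin pA nh; rewrite leqNgt; apply/negP.
have [B [pB]] := bounding_box pA nh; move: #|` cols A| #|` rows A| => p q Br nB lt.
have bd := in_rect_bound pB Br nB h0.
have [p2 q2] : (1 < p)%N /\ (1 < q)%N by clear -bd; nia.
have [n [e [e1 pq]]] : exists n e, (e <= 1)%N /\ (p + q = 2 * n + e)%N.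
  by exists ((p + q) %/ 2)%N, ((p + q) %% 2)%N; clear; lia.
have n1 : (1 <= n)%N by clear -pq p2 q2 e1; lia.
have n0 : (0 < n + e)%N by clear -n1; lia.
have [m Hm] := hmax_ex n1 n0.
have sm : (n * (n + e) < N * (N + b))%N.
  have [nN|[-> [-> ->]]] : (n < N \/ n = N /\ e = 0 /\ b = 1)%N by clear -lt pq e1 b1; lia.
    apply: (@leq_trans (N * N)); last by rewrite leq_mul2l leq_addr orbT.
    apply: (@leq_ltn_trans (n * N)); last by rewrite ltn_mul2r nN N1.
    by rewrite leq_mul2l; clear -nN e1; lia.
  by clear -N1; nia.
have := Hmin n e m e1 n1 sm Hm; rewrite ltnNge => /negP; apply.
have [_ mx] := Hm.
have [[pn qn]|[[pn qn]|[ne1 ne2]]] : (p = n /\ q = n + e \/ q = n /\ p = n + e \/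
    p <> n /\ q <> n)%N by clear -pq; lia.
- by subst p q; apply: mx; exists B.
- by subst p q; have [C HC] := in_rect_swap pB Br nB; apply: mx; exists C.
apply: leq_trans (hmax_opt e1 Hm); apply: opt_ge.
have [e0|e0] : e = 0%N \/ e = 1%N by clear -e1; lia.
  subst e; have := square_mod3 (n - 1) h; rewrite addn0.
  have : (3 * h + 2 <= (n - 1) * (n - 1))%N by clear -bd pq ne1 p2 q2; nia.
  by move: ((n - 1) * (n - 1))%N => z; clear; lia.
subst e; clear -bd pq ne1 ne2 p2 q2; nia.
Qed.

Lemma config_3_3 : config 3 3 (seq_fset tt [:: (1, 1)]).
Proof.
apply: config_near => //; first exact: sparse_seq.
move=> [x y]; rewrite mem_rectR seq_fsetE mem_seq1 xpair_eqE /interior /=.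
by clear; lia.
Qed.

Lemma tight_cut_corner N R : config N N R -> (1 < N)%N ->
  (3 * #|` R| + 1 = (N - 1) * (N - 1))%N -> tight (2 * N) #|` R|.
Proof.
move=> cR N1 D; exists (rect N N `\` R `\ (0, 0)); split.
- exact: cutcorner.
- apply/pits_num/sparse_pits; first by case: cR.
  by move=> k; rewrite inE => /eqP ->.
- have Kb k : k \in [fset (0, 0)] -> border N N k.
    by rewrite inE => /eqP ->; apply: corner00; clear -N1; lia.
  have := card_board cR.1 Kb; rewrite cardfs1.
  by move: #|` _ `\ _| #|` R| D => n k D; clear -D N1; nia.
Qed.

Lemma minimal_tight N b ha h : (b <= 1)%N -> (1 <= N)%N -> hmax_is N (N + b) ha ->
  (0 < h)%N -> (h <= ha)%N -> minimal_box N b h -> tight (2 * N + b) h.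
Proof.
move=> b1 N1 Hm h0 hha Hmin; have ha0 := leq_trans h0 hha.
have [[A [pA Ar nA]] _] := Hm.
have [R cR cc] := config_of_polyomino pA Ar nA ha0.
have R0 : R != fset0 by rewrite -cardfs_gt0 cc.
have [N2 M2] := config_bases cR R0; have bd := config_bound cR R0; rewrite cc in bd.
have prev n e : (e <= 1)%N -> (1 <= n)%N -> (n * (n + e) < N * (N + b))%N ->
    (opt n (n + e) < h)%N.
  move=> e1 n1 lt; have [|m Hm'] := @hmax_ex n (n + e) n1; first by clear -n1; lia.
  exact: leq_ltn_trans (hmax_opt e1 Hm') (Hmin n e m e1 n1 lt Hm').
have [hopt|hopt] := leqP h (opt N (N + b)).
  (* The case [h = 1] contradicts minimality here: the 3 x 3 box already holds one hole, while
     [opt 3 3 = 0]. *)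
  have [h1|h1] := leqP h 1.
    have [m Hm'] := @hmax_ex 3 3 isT isT.
    have m1 : (1 <= m)%N.
      by have := hmax_config Hm' config_3_3; rewrite size_seq_fset undup_id.
    have : (m < h)%N.
      apply: (Hmin 3 0 m) => //; move: hopt; case: (ltnP 3 N) => [N3 _|N3].
        by clear -N3; nia.
      have -> : N = 3%N by clear -N3 N2; lia.
      by case: b b1 {prev Hmin Hm Ar cR bd M2} => [|[|]] // _; rewrite /opt /=; clear -h0; lia.
    by clear -m1 h1; lia.
  have [e|e] : b = 0%N \/ b = 1%N by clear -b1; lia.
    subst b; rewrite !addn0 in hopt *; apply: tight_square => //.
    have := prev (N - 1)%N 1%N; rewrite subnK //; apply=> //; first by clear -N2; lia.
    by clear -N2; nia.
  subst b; apply: tight_rectangle => //; have := prev N 0%N; rewrite addn0; apply=> //.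
  by clear -N2; nia.
have lo : ((N - 1) * (N + b - 1) <= 3 * h + 2)%N.
  by rewrite leqNgt; apply/negP => H; have : (h <= opt N (N + b))%N;
    [apply: opt_ge; clear -H; lia|clear -hopt; lia].
(* 3 [ha] + 1 <= (N-1)(M-1) <= 3 [h] + 2 leaves no room between [h] and [ha]. *)
have hE : h = ha by move: bd lo; move: ((N - 1) * (N + b - 1))%N => z; clear -hha; lia.
rewrite -hE in cc bd; have [e|e] : b = 0%N \/ b = 1%N by clear -b1; lia.
  subst b; rewrite !addn0 in cR bd lo *; rewrite -cc; apply: tight_cut_corner => //.
    by clear -N2; lia.
  rewrite cc; have := square_mod3 (N - 1) h.
  by move: bd lo; move: ((N - 1) * (N - 1))%N => z; clear; lia.
(* In a rectangle the product is pronic, so it is not 3h + 1; the value 3h + 2 contradicts the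
   improved bound, as one of the sides N, N + 1 is even. *)
exfalso; subst b; have np := pronic_mod3 (N - 1) h.
rewrite subnK // in np; rewrite addnK in bd lo.
have [o|o] := boolP (odd N).
  have R0' : swap @` R != fset0 by rewrite -cardfs_gt0 (card_iso iso_swap) cc.
  have [N3|N3] := ltnP 3 N; last first.
    have eN : N = 3%N by clear -N3 N2; lia.
    by subst N; clear -bd lo; lia.
  have := config_bound_even (config_swap cR) R0' _ N3.
  rewrite (card_iso iso_swap) cc addnK (mulnC N) => H.
  have {}H := H _; move: (H ltac:(by clear -o; lia)) np lo.
  by move: ((N - 1) * N)%N => z; clear; lia.
have M3 : (3 < N + 1)%N by clear -N2; lia.
have := config_bound_even cR R0 o M3; rewrite cc addnK; move: np lo.
by move: ((N - 1) * N)%N => z; clear; lia.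
Qed.

Lemma g_of_minimal N b ha h : (b <= 1)%N -> (1 <= N)%N -> hmax_is N (N + b) ha ->
  (0 < h)%N -> (h <= ha)%N -> minimal_box N b h ->
  exists g, g_is h g /\ (g + 1 = 2 * h + (2 * N + b))%N.
Proof.
move=> b1 N1 Hm h0 hha Hmin.
have [A [pA nA cA]] := minimal_tight b1 N1 Hm h0 hha Hmin.
exists #|` A|; split=> //; split; first by exists A.
move=> k [B [pB nB <-]]; have := tile_bound pB nB.
have := minimal_semiperimeter b1 N1 h0 Hmin pB nB; move: cA.
by move: #|` A| #|` B| #|` cols B| #|` rows B| => a b' c d; clear; lia.
Qed.

Lemma smallest_alpha_ex h : exists N b ha, smallest_alpha h N b ha.
Proof.
pose P v := exists N b ha,
  [/\ (b <= 1)%N, (1 <= N)%N, hmax_is N (N + b) ha, (h <= ha)%N & v = (N * (N + b))%N].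
(* A crude but sufficient side: (3h+3)^2 >= 3h + 3, so [opt] of this square is at least [h]. *)
have [m Hm] := @hmax_ex (3 * h + 4) (3 * h + 4 + 0) ltac:(lia) ltac:(lia).
have [|v [[N [b [ha [b1 N1 Hha hha ->]]]] vmin]] :=
    @ex_is_min P ((3 * h + 4) * (3 * h + 4 + 0)).
  exists (3 * h + 4)%N, 0%N, m; split=> //; first by lia.
  by apply: leq_trans (hmax_opt _ Hm) => //; apply: opt_ge; nia.
exists N, b, ha; split=> // N' b' ha' b1' N1' lt H'; rewrite ltnNge; apply/negP => le.
have : (N * (N + b) <= N' * (N' + b'))%N by apply: vmin; exists N', b', ha'.
by rewrite leqNgt lt.
Qed.

Local Close Scope ring_scope.
Local Close Scope fset_scope.

Theorem theorem3 (h : nat) (hpos : (1 <= h)%N) :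
  (exists N b ha, smallest_alpha h N b ha) /\
  (forall N b ha, smallest_alpha h N b ha ->
     exists gh gha, [/\ g_is h gh, g_is ha gha & gh + 2 * (ha - h) = gha]%N).
Proof.
split=> [|N b ha [b1 N1 Hm hha Hmin]]; first exact: smallest_alpha_ex.
have [g [Hg eg]] := g_of_minimal b1 N1 Hm hpos hha Hmin.
(* Smaller boxes hold fewer than [h] holes, hence fewer than [ha]; so both g-values are given by the
   same N and b. *)
have Hmin' : minimal_box N b ha.
  by move=> N' b' ha' ? ? ? ?; apply: leq_trans hha; apply: (Hmin N' b' ha').
have [g' [Hg' eg']] := g_of_minimal b1 N1 Hm (leq_trans hpos hha) (leqnn ha) Hmin'.
exists g, g'; split=> //; clear -eg eg' hha; lia.
Qed.
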